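(* The semicircle transform $\mathcal W\colon\mathcal M(\mathbb S^2)\to\mathcal M(\mathrm{SO}(3))$ of measures is injective.
   Context: $\mathcal M(X)$ denotes the finite signed Borel measures on a compact metric space $X$. $\mathbb S^2\subset\mathbb R^3$ is the unit sphere, $\mathbb T=\mathbb R/(2\pi\mathbb Z)$, and $\Phi(\varphi,\vartheta)=(\cos\varphi\sin\vartheta,\sin\varphi\sin\vartheta,\cos\vartheta)$. The azimuth $\mathrm{azi}(\xi)\in\mathbb T$ and zenith angle $\mathrm{zen}(\xi)\in[0,\pi]$ are defined by $\mathrm{azi}(\Phi(\varphi,\vartheta))=\varphi$, $\mathrm{zen}(\Phi(\varphi,\vartheta))=\vartheta$ for $\varphi\in\mathbb T,\vartheta\in(0,\pi)$, and for the poles ($\vartheta\in\{0,\pi\}$) the azimuth is set to $0$. Euler angles: $\Psi(\alpha,\beta,\gamma)=R_3(\alpha)R_2(\beta)R_3(\gamma)\in\mathrm{SO}(3)$, $\alpha,\gamma\in\mathbb T,\beta\in[0,\pi]$, with $$R_3(\alpha)=\begin{pmatrix}\cos\alpha&-\sin\alpha&0\\ \sin\alpha&\cos\alpha&0\\0&0&1\end{pmatrix},\quad R_2(\beta)=\begin{pmatrix}\cos\beta&0&\sin\beta\\0&1&0\\-\sin\beta&0&\cos\beta\end{pmatrix}.$$ The azimuth operator is $\mathcal A_{\alpha,\beta}\colon\mathbb S^2\to\mathbb T$, $\mathcal A_{\alpha,\beta}(\xi)=\mathrm{azi}(\Psi(\alpha,\beta,0)^\top\xi)$. Let $u_{\mathbb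 S^2}=(4\pi)^{-1}\sigma_{\mathbb S^2}$ be the uniform probability measure on $\mathbb S^2$ ($\sigma_{\mathbb S^2}$ the surface measure). The (normalized) semicircle transform of $\mu\in\mathcal M(\mathbb S^2)$ is the push-forward $$\mathcal W\mu:=(T_{\mathcal W})_\#(u_{\mathbb S^2}\times\mu),\qquad T_{\mathcal W}(\Phi(\alpha,\beta),\xi):=\Psi(\alpha,\beta,\mathcal A_{\alpha,\beta}(\xi)),$$ where $\alpha,\beta$ are the azimuth and zenith angle of the first argument and $T_\#\mu=\mu\circ T^{-1}$. *)

(* Defs.v *)
From HB Require Import structures.
From mathcomp Require Import all_boot all_order all_algebra.
From mathcomp Require Import all_classical all_reals all_analysis.
From mathcomp Require Import measurable_realfun.
From mathcomp Require Import ring lra.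

Set Implicit Arguments.
Unset Strict Implicit.
Unset Printing Implicit Defensive.

Import Order.TTheory GRing.Theory Num.Theory.
Import numFieldNormedType.Exports.

Local Open Scope classical_set_scope.
Local Open Scope ring_scope.

Section rotations.
Context {R : realType}.
Implicit Types a b g t : R.

Definition Phi_vec (phi theta : R) : 'cV[R]_3 :=
  \col_i [:: cos phi * sin theta; sin phi * sin theta; cos theta]`_i.

Definition R2 b : 'M[R]_3 := \matrix_(i, j)
  (nth [::] [:: [:: cos b;   0; sin b];
                [:: 0;       1; 0];
                [:: - sin b; 0; cos b]] i)`_j.

Definition R3 a : 'M[R]_3 := \matrix_(i, j)
  (nth [::] [:: [:: cos a; - sin a; 0];
                [:: sin a; cos a;   0];
                [:: 0;     0;       1]] i)`_j.

Definition Psi_mx a b g : 'M[R]_3 := R3 a *m R2 b *m R3 g.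

End rotations.

Definition sphere_set (R : realType) : set 'cV[R]_3 :=
  [set v | \sum_i v i 0 ^+ 2 = 1].

Definition SO3_set (R : realType) : set 'M[R]_3 :=
  [set A | A^T *m A = 1%:M /\ \det A = 1].

Lemma Phi_vecP (R : realType) (phi theta : R) : sphere_set (Phi_vec phi theta).
Proof.
rewrite /sphere_set /= !big_ord_recl big_ord0 !mxE /=.
have h1 := cos2Dsin2 phi; have h2 := cos2Dsin2 theta.
transitivity ((cos phi ^+ 2 + sin phi ^+ 2) * sin theta ^+ 2 + cos theta ^+ 2).
  by ring.
by rewrite h1 mul1r addrC.
Qed.

Lemma R2_SO3 (R : realType) (b : R) : SO3_set (R2 b).
Proof.
have h := cos2Dsin2 b; split.
  apply/matrixP => -[[|[|[|//]]] hi] [[|[|[|//]]] hj];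
  rewrite !mxE !big_ord_recl big_ord0 !mxE /=; nra.
rewrite (expand_det_row _ ord0) !big_ord_recl big_ord0 /cofactor.
rewrite !(expand_det_row _ ord0) !big_ord_recl !big_ord0 /cofactor !det_mx11.
rewrite !mxE /= /bump /= !expr0 ?expr1; nra.
Qed.

Lemma R3_SO3 (R : realType) (a : R) : SO3_set (R3 a).
Proof.
have h := cos2Dsin2 a; split.
  apply/matrixP => -[[|[|[|//]]] hi] [[|[|[|//]]] hj];
  rewrite !mxE !big_ord_recl big_ord0 !mxE /=; nra.
rewrite (expand_det_row _ ord0) !big_ord_recl big_ord0 /cofactor.
rewrite !(expand_det_row _ ord0) !big_ord_recl !big_ord0 /cofactor !det_mx11.
rewrite !mxE /= /bump /= !expr0 ?expr1; nra.
Qed.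

Lemma SO3_mul (R : realType) (A B : 'M[R]_3) :
  SO3_set A -> SO3_set B -> SO3_set (A *m B).
Proof.
move=> [A1 A2] [B1 B2]; split; last by rewrite det_mulmx A2 B2 mulr1.
by rewrite trmx_mul mulmxA -(mulmxA B^T) A1 mulmx1.
Qed.

Lemma Psi_mxP (R : realType) (a b g : R) : SO3_set (Psi_mx a b g).
Proof.
by apply: SO3_mul (R3_SO3 g); apply: SO3_mul (R2_SO3 b); exact: R3_SO3.
Qed.

(* S2 and SO3 carry the subspace topology inherited from the matrix spaces and
   the Borel sigma-algebra of that topology. *)
Definition S2 (R : realType) : Type := set_type (@sphere_set R).
HB.instance Definition _ (R : realType) :=
  Topological.copy (S2 R) (set_type (@sphere_set R)).
HB.instance Definition _ (R : realType) :=
  SubType.copy (S2 R) (set_type (@sphere_set R)).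
Definition Phi (R : realType) (phi theta : R) : S2 R :=
  SigSub (mem_set (Phi_vecP phi theta)).
HB.instance Definition _ (R : realType) := isPointed.Build (S2 R) (Phi 0 0).
HB.instance Definition _ (R : realType) :=
  Measurable.copy (S2 R) (g_sigma_algebraType (@open (S2 R))).

Definition SO3 (R : realType) : Type := set_type (@SO3_set R).
HB.instance Definition _ (R : realType) :=
  Topological.copy (SO3 R) (set_type (@SO3_set R)).
HB.instance Definition _ (R : realType) :=
  SubType.copy (SO3 R) (set_type (@SO3_set R)).
Definition Psi (R : realType) (a b g : R) : SO3 R :=
  SigSub (mem_set (Psi_mxP a b g)).
HB.instance Definition _ (R : realType) := isPointed.Build (SO3 R) (Psi 0 0 0).
HB.instance Definition _ (R : realType) :=
  Measurable.copy (SO3 R) (g_sigma_algebraType (@open (SO3 R))).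


Lemma S2P (R : realType) (x : S2 R) : sphere_set (val x).
Proof. exact: set_mem (valP x). Qed.

Lemma SO3P (R : realType) (A : SO3 R) : SO3_set (val A).
Proof. exact: set_mem (valP A). Qed.

Lemma sphere_trmul (R : realType) (A : 'M[R]_3) (v : 'cV[R]_3) :
  SO3_set A -> sphere_set v -> sphere_set (A^T *m v).
Proof.
move=> [AA _]; have normE (w : 'cV[R]_3) : \sum_i w i 0 ^+ 2 = (w^T *m w) 0 0.
  by rewrite mxE; apply: eq_bigr => i _; rewrite mxE.
rewrite /sphere_set/= !normE trmx_mul trmxK -mulmxA (mulmxA A).
by rewrite (mulmx1C AA) mul1mx.
Qed.

(* x |-> A^T x on the sphere *)
Definition rotT (R : realType) (A : SO3 R) (x : S2 R) : S2 R :=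
  SigSub (mem_set (sphere_trmul (SO3P A) (S2P x))).

(* T = R/(2 pi Z) is represented by [0, 2 pi[. At the poles no theta in ]0, pi[
   exists, so that xget returns its default value 0, which is the convention for
   the azimuth of the poles. *)
Definition azi (R : realType) (x : S2 R) : R :=
  xget 0 [set phi | 0 <= phi < 2 * pi /\
                    exists2 theta, 0 < theta < pi & x = Phi phi theta].

Definition zen (R : realType) (x : S2 R) : R :=
  xget 0 [set theta | 0 <= theta <= pi /\ exists phi, x = Phi phi theta].

Definition azimuth_op (R : realType) (a b : R) (x : S2 R) : R :=
  azi (rotT (Psi a b 0) x).

Section spherical_coordinates.
Context {R : realType}.
Implicit Types (a b phi theta : R) (x : S2 R).

Lemma PhiE phi theta : val (Phi phi theta) = Phi_vec phi theta.
Proof. by []. Qed.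

Lemma angle_inj a b : 0 <= a < 2 * pi -> 0 <= b < 2 * pi ->
  cos a = cos b -> sin a = sin b -> a = b.
Proof.
wlog ba : a b / b <= a.
  move=> h a0 b0 c s; have [ba|ab] := leP b a; first exact: h.
  by apply/esym/h => //; exact: ltW.
move=> /andP[a0 a2] /andP[b0 b2] c s.
have d1 : cos (((a - b) / 2) *+ 2) = 1.
  by rewrite -[_ *+ 2]mulr_natr divfK ?pnatr_eq0// cosB c s -!expr2 cos2Dsin2.
rewrite cos_mulr2n in d1; have := cos2Dsin2 ((a - b) / 2) => d2.
have d3 : sin ((a - b) / 2) = 0 by nra.
have [|ltab] := ltP 0 ((a - b) / 2); last by lra.
move=> d0; have := @sin_gt0_pi _ ((a - b) / 2).
rewrite d3 ltxx d0 /=; have -> : (a - b) / 2 < pi by lra.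
by move/(_ isT).
Qed.

Lemma Phi_eqP phi theta x : x = Phi phi theta <->
  [/\ val x 0 0 = cos phi * sin theta, val x 1 0 = sin phi * sin theta &
      val x 2%:R 0 = cos theta].
Proof.
split=> [->|[h0 h1 h2]]; first by rewrite PhiE !mxE.
apply/val_inj/matrixP => -[[|[|[|//]]] hi] j; rewrite ord1 PhiE [RHS]mxE /=.
- by rewrite -h0; congr (val x _ _); exact: val_inj.
- by rewrite -h1; congr (val x _ _); exact: val_inj.
- by rewrite -h2; congr (val x _ _); exact: val_inj.
Qed.

Lemma S2E x : val x 0 0 ^+ 2 + val x 1 0 ^+ 2 + val x 2%:R 0 ^+ 2 = 1.
Proof.
have := S2P x; rewrite /sphere_set/= !big_ord_recl big_ord0 addr0 addrA => <-.
by congr (_ + _ + _); congr (val x _ _ ^+ _); exact: val_inj.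
Qed.

Lemma azi_Phi phi theta : 0 <= phi < 2 * pi -> 0 < theta < pi ->
  azi (Phi phi theta) = phi.
Proof.
move=> hphi htheta; rewrite /azi; apply: xget_unique.
  by split => //; exists theta.
move=> b [hb [theta' htheta' /esym /Phi_eqP]].
rewrite PhiE !mxE /= => -[h0 h1 h2].
have h : theta' = theta.
  by apply: cos_inj => //; rewrite in_itv/=; lra.
rewrite h in h0 h1; have s0 := sin_gt0_pi htheta.
by apply: angle_inj => //; apply: (mulIf (lt0r_neq0 s0)).
Qed.

Lemma zen_Phi phi theta : 0 <= theta <= pi -> zen (Phi phi theta) = theta.
Proof.
move=> htheta; rewrite /zen; apply: xget_unique.
  by split => //; exists phi.
move=> b [hb [phi' /esym /Phi_eqP]]; rewrite PhiE !mxE /= => -[_ _ h2].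
by apply: cos_inj => //; rewrite in_itv.
Qed.

Lemma azi_pole theta : theta = 0 \/ theta = pi -> azi (Phi 0 theta) = 0.
Proof.
move=> h; rewrite /azi; apply: xgetPN => phi [_ [theta' htheta']].
move/Phi_eqP; rewrite PhiE !mxE /= => -[_ _].
have s0 := sin_gt0_pi htheta'; have h2 := cos2Dsin2 theta'.
by case: h => ->; rewrite ?cos0 ?cospi => e; nra.
Qed.

(* acos is only specified on [-1, 1] *)
Definition acos_clip (r : R) : R := acos (Num.min 1 (Num.max (-1) r)).

Definition azi_fun (r s : R) : R :=
  let n := Num.sqrt (r ^+ 2 + s ^+ 2) in
  if n == 0 then 0 else
  if 0 <= s then acos_clip (r / n) else 2 * pi - acos_clip (r / n).

Lemma acos_clipE r : -1 <= r <= 1 -> acos_clip r = acos r.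
Proof.
by move=> /andP[r1 r2]; rewrite /acos_clip max_r// min_r.
Qed.

Lemma azi_funP r s : r ^+ 2 + s ^+ 2 != 0 ->
  let n := Num.sqrt (r ^+ 2 + s ^+ 2) in
  [/\ 0 <= azi_fun r s < 2 * pi, r = n * cos (azi_fun r s) &
      s = n * sin (azi_fun r s)].
Proof.
move=> rs0 n; have n2 : n ^+ 2 = r ^+ 2 + s ^+ 2.
  by rewrite sqr_sqrtr// addr_ge0 ?sqr_ge0.
have n0 : 0 <= n by exact: sqrtr_ge0.
have npos : 0 < n.
  by rewrite lt_def n0 andbT; apply: contra rs0 => /eqP n00; rewrite -n2 n00 expr0n.
have nn : n != 0 by rewrite lt0r_neq0.
have rn : -1 <= r / n <= 1.
  by rewrite ler_pdivlMr// ler_pdivrMr//; apply/andP; split; nra.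
have pi0 := @pi_gt0 R.
have [a0 ap] := (acos_ge0 rn, acos_lepi rn).
have ca : cos (acos (r / n)) = r / n by rewrite acosK// in_itv.
have sa0 : 0 <= sin (acos (r / n)) by rewrite sin_ge0_pi// a0.
have sa := cos2Dsin2 (acos (r / n)).
have sa2 : (n * sin (acos (r / n))) ^+ 2 = s ^+ 2.
  have -> : s ^+ 2 = n ^+ 2 * 1 - r ^+ 2 by rewrite n2; ring.
  by rewrite -sa ca; field.
rewrite /azi_fun -/n (negbTE nn) acos_clipE//; case: ifPn => s0.
  split; first by rewrite a0/=; lra.
    by rewrite ca; field.
  by apply/eqP; rewrite -(@eqrXn2 _ 2)// ?sa2// mulr_ge0.
move: s0; rewrite -ltNge => s0.
have sE : s = - (n * sin (acos (r / n))).
  apply: oppr_inj; rewrite opprK; apply/eqP.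
  by rewrite -(@eqrXn2 _ 2)// ?sa2 ?sqrrN// ?mulr_ge0// oppr_ge0 ltW.
have apos : 0 < acos (r / n).
  rewrite lt_def a0 andbT; apply/eqP => e; rewrite e sin0 mulr0 oppr0 in sE.
  by rewrite sE ltxx in s0.
have -> : 2 * pi - acos (r / n) = - acos (r / n) + pi *+ 2 by ring.
split.
- by rewrite -mulr_natl; apply/andP; split; lra.
- by rewrite cosD2pi cosN ca; field.
- by rewrite sinD2pi sinN mulrN.
Qed.

Lemma zenE x : zen x = acos (val x 2%:R 0) /\ exists phi, x = Phi phi (zen x).
Proof.
have h := S2E x; set r := val x 0 0 in h; set s := val x 1 0 in h.
set z := val x 2%:R 0 in h *.
have z1 : -1 <= z <= 1 by apply/andP; split; nra.
have [a0 ap] := (acos_ge0 z1, acos_lepi z1).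
have ca : cos (acos z) = z by rewrite acosK// in_itv.
have sa0 : 0 <= sin (acos z) by rewrite sin_ge0_pi// a0.
have sa := cos2Dsin2 (acos z); rewrite ca in sa.
suff [phi xE] : exists phi, x = Phi phi (acos z).
  have -> : zen x = acos z by rewrite xE zen_Phi// a0.
  by split=> //; exists phi.
have nE : Num.sqrt (r ^+ 2 + s ^+ 2) = sin (acos z).
  have -> : r ^+ 2 + s ^+ 2 = sin (acos z) ^+ 2 by lra.
  by rewrite sqrtr_sqr ger0_norm.
have [rs0|rs0] := eqVneq (r ^+ 2 + s ^+ 2) 0.
  exists 0; apply/Phi_eqP; rewrite -/r -/s -/z -nE rs0 sqrtr0 !mulr0 ca.
  by split => //; nra.
exists (azi_fun r s); apply/Phi_eqP; rewrite -/r -/s -/z -nE ca.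
have [_ h1 h2] := azi_funP rs0; split => //.
- by rewrite mulrC.
- by rewrite mulrC.
Qed.

Lemma aziE x : azi x = azi_fun (val x 0 0) (val x 1 0).
Proof.
have [zE [phi xE]] := zenE x; have h := S2E x.
set r := val x 0 0 in h *; set s := val x 1 0 in h *.
set z := val x 2%:R 0 in h *.
have [e0 e1 e2] := (Phi_eqP _ _ _).1 xE; rewrite -/r -/s -/z in e0 e1 e2 zE.
have z1 : -1 <= z <= 1 by apply/andP; split; nra.
have [a0 ap] := (acos_ge0 z1, acos_lepi z1); rewrite -zE in a0 ap.
have sa := cos2Dsin2 (zen x); rewrite -e2 in sa.
have sa0 : 0 <= sin (zen x) by rewrite sin_ge0_pi// a0.
have [rs0|rs0] := eqVneq (r ^+ 2 + s ^+ 2) 0.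
  rewrite /azi_fun rs0 sqrtr0 eqxx; apply: xgetPN => b [_ [t ht]].
  move/Phi_eqP => -[]; rewrite -/r -/s -/z => _ _ zt.
  by have := sin_gt0_pi ht; have := cos2Dsin2 t; rewrite -zt; nra.
have nE : Num.sqrt (r ^+ 2 + s ^+ 2) = sin (zen x).
  have -> : r ^+ 2 + s ^+ 2 = sin (zen x) ^+ 2 by lra.
  by rewrite sqrtr_sqr ger0_norm.
have [h0 h1 h2] := azi_funP rs0; rewrite nE in h1 h2.
have -> : x = Phi (azi_fun r s) (zen x).
  by apply/Phi_eqP; rewrite -/r -/s -/z; split; rewrite // mulrC.
rewrite azi_Phi//.
have zn : sin (zen x) != 0.
  by apply: contra rs0 => /eqP z0; apply/eqP; rewrite z0 in sa; nra.
rewrite !lt_def a0 ap !andbT; apply/andP; split.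
  by apply: contra zn => /eqP ->; rewrite sin0.
by apply: contra zn => /eqP <-; rewrite sinpi.
Qed.

End spherical_coordinates.

Section borel_measurability.
Context {R : realType}.

Lemma measurable_coord m n (D : set 'M[R]_(m, n)) i j (U : set R) :
  open U -> @open (set_type D) [set x : set_type D | U ((set_val x : 'M[R]_(m, n)) i j)].
Proof.
move=> oU; exists [set v : 'M[R]_(m, n) | U (v i j)] => //.
by have /continuousP := @coord_continuous R m n i j; exact.
Qed.

Lemma measurable_mx_open d (X : measurableType d) m n
    (f : X -> 'M[R]_(m, n)) (U : set 'M[R]_(m, n)) :
  (forall i j, measurable_fun setT (fun x => f x i j)) ->
  open U -> measurable (f @^-1` U).
Proof.
move=> mf oU.
pose K := ('M[rat]_(m, n) * nat)%type.
pose B (k : K) : set 'M[R]_(m, n) :=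
  [set v | forall i j, `|v i j - ratr (k.1 i j)| < k.2.+1%:R^-1].
have mB k : measurable (f @^-1` B k).
  have -> : f @^-1` B k = \bigcap_(ij in [set: 'I_m * 'I_n])
      [set x | `|f x ij.1 ij.2 - ratr (k.1 ij.1 ij.2)| < k.2.+1%:R^-1].
    apply/seteqP; split=> [x h [i j] _ /=|x h i j]; first exact: h.
    exact: (h (i, j)).
  apply: fin_bigcap_measurable => // -[i j] _ /=.
  rewrite -[X in measurable X]setTI.
  have : measurable_fun setT (fun x => `|f x i j - ratr (k.1 i j)|).
    apply: measurableT_comp => //.
    by apply: measurable_funB => //; exact: measurable_cst.
  move=> /(_ measurableT `]-oo, k.2.+1%:R^-1[%classic (measurable_itv _)).
  by congr (measurable (_ `&` _)).
have -> : f @^-1` U = \bigcup_(k in [set k | B k `<=` U]) (f @^-1` B k).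
  apply/seteqP; split=> x /=; last by move=> [k kU] /kU.
  move=> Ufx.
  have /nbhs_ballP[e /= e0 eU] : nbhs (f x) U by exact: open_nbhs_nbhs.
  have e20 : 0 < e / 2 by rewrite divr_gt0.
  have [k _ /(_ k (leqnn k))/= ke] := near_infty_natSinv_lt (PosNum e20).
  have k0 : 0 < k.+1%:R^-1 :> R by rewrite invr_gt0.
  pose c : R := k.+1%:R^-1; rewrite -/c in k0 ke.
  have qP i j : exists q : rat, `|f x i j - ratr q| < c.
    have [|q] := @rat_in_itvoo R (f x i j) (f x i j + c).
      by rewrite ltrDl.
    rewrite in_itv/= => /andP[q1 q2]; exists q.
    by rewrite ltr_norml; apply/andP; split; move: q1 q2 k0; clear; lra.
  exists (\matrix_(i, j) sval (cid (qP i j)), k) => /=; last first.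
    by move=> i j; rewrite mxE; case: cid.
  move=> v vB; apply: eU; split=> // i j.
  have := vB i j; rewrite /= mxE; case: cid => q /= hq; rewrite -/c => hv.
  rewrite -ball_normE /ball_/=.
  have -> : f x i j - v i j = (f x i j - ratr q) - (v i j - ratr q) by ring.
  by rewrite (le_lt_trans (ler_normB _ _))//; lra.
rewrite bigcup_mkcond; apply: countable_bigcupT_measurable => [|k].
  exact: countableP.
by case: ifPn.
Qed.

Lemma measurable_set_type d (X : measurableType d) m n (D : set 'M[R]_(m, n))
    (f : X -> set_type D) :
  (forall i j, measurable_fun setT (fun x => set_val (f x) i j)) ->
  forall A, <<s @open (set_type D) >> A -> measurable (f @^-1` A).
Proof.
move=> mf; apply: smallest_sub.
  split; first by rewrite preimage_set0.
    by move=> A mA; rewrite setTD; exact: measurableC.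
  by move=> F mF; rewrite preimage_bigcup; exact: bigcupT_measurable.
by move=> _ [U oU <-]; rewrite -comp_preimage; exact: measurable_mx_open.
Qed.

Lemma measurable_to_S2 d (X : measurableType d) (f : X -> S2 R) :
  (forall i, measurable_fun setT (fun x => val (f x) i 0)) ->
  measurable_fun setT f.
Proof.
move=> mf _ A mA; rewrite setTI; apply: measurable_set_type mA => i j.
by rewrite ord1; exact: mf.
Qed.

Lemma measurable_to_SO3 d (X : measurableType d) (f : X -> SO3 R) :
  (forall i j, measurable_fun setT (fun x => val (f x) i j)) ->
  measurable_fun setT f.
Proof. by move=> mf _ A mA; rewrite setTI; exact: measurable_set_type mA. Qed.

Lemma measurable_S2_coord i :
  measurable_fun setT (fun x : S2 R => val x i 0).
Proof.
apply: (measurability _ (RGenOpens.measurableE R)).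
move=> _ [_ [a [b ->] <-]]; rewrite setTI; apply: sub_sigma_algebra.
apply: (@measurable_coord _ _ (@sphere_set R) i 0).
exact: interval_open.
Qed.

Lemma measurable_acos_clip : measurable_fun setT (@acos_clip R).
Proof.
apply: nonincreasing_measurable => // a b ab; rewrite /acos_clip.
set v := Num.min 1 _; set u := Num.min 1 _.
have uv : u <= v.
  by rewrite /u /v le_min !ge_min lexx /= !ge_max !le_max lexx ab !orbT.
have clip (r : R) : -1 <= Num.min 1 (Num.max (-1) r) <= 1.
  by rewrite le_min ge_min le_max !lexx /= andbT; lra.
rewrite leNgt; apply/negP => h.
have := @ltr_cos R (acos u) (acos v).
rewrite !in_itv/= !acos_ge0 ?acos_lepi ?clip// => /(_ isT isT).
by rewrite h !acosK ?in_itv ?clip// ltNge uv.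
Qed.

Lemma measurable_azi_fun d (X : measurableType d) (f g : X -> R) :
  measurable_fun setT f -> measurable_fun setT g ->
  measurable_fun setT (fun x => azi_fun (f x) (g x)).
Proof.
move=> mf mg; rewrite /azi_fun.
have mn : measurable_fun setT (fun x => Num.sqrt (f x ^+ 2 + g x ^+ 2)).
  apply: measurableT_comp.
    by apply: continuous_measurable_fun; exact: sqrt_continuous.
  by apply: measurable_funD; exact: measurable_funX.
have mV : measurable_fun setT (fun x => (Num.sqrt (f x ^+ 2 + g x ^+ 2))^-1).
  have -> : (fun x => (Num.sqrt (f x ^+ 2 + g x ^+ 2))^-1) =
      (fun x => Num.sqrt (f x ^+ 2 + g x ^+ 2) `^ (-1)).
    by apply/funext => x; rewrite powR_inv1// sqrtr_ge0.
  exact: (measurableT_comp (measurable_powR (-1)) mn).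
have ma : measurable_fun setT
    (fun x => acos_clip (f x / Num.sqrt (f x ^+ 2 + g x ^+ 2))).
  apply: measurableT_comp; first exact: measurable_acos_clip.
  exact: measurable_funM.
apply: measurable_fun_ifT => //.
  exact: measurable_fun_eqr.
apply: measurable_fun_ifT => //.
  exact: measurable_fun_ler.
exact: measurable_funB.
Qed.

Lemma measurable_azi d (X : measurableType d) (f : X -> S2 R) :
  (forall i, measurable_fun setT (fun x => val (f x) i 0)) ->
  measurable_fun setT (@azi R \o f).
Proof.
move=> mf; have -> : @azi R \o f =
    (fun x => azi_fun (val (f x) 0 0) (val (f x) 1 0)).
  by apply/funext => x /=; rewrite aziE.
exact: measurable_azi_fun.
Qed.

Lemma measurable_mulmx d (X : measurableType d) m n p
    (A : X -> 'M[R]_(m, n)) (B : X -> 'M[R]_(n, p)) :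
  (forall i j, measurable_fun setT (fun x => A x i j)) ->
  (forall i j, measurable_fun setT (fun x => B x i j)) ->
  forall i j, measurable_fun setT (fun x => (A x *m B x) i j).
Proof.
move=> mA mB i j; under eq_fun do rewrite mxE.
by apply: measurable_sum => k; exact: measurable_funM.
Qed.

Lemma measurable_Psi_mx d (X : measurableType d) (a b g : X -> R) :
  measurable_fun setT a -> measurable_fun setT b -> measurable_fun setT g ->
  forall i j, measurable_fun setT (fun x => Psi_mx (a x) (b x) (g x) i j).
Proof.
have mc (f : X -> R) : measurable_fun setT f ->
    measurable_fun setT (fun x => cos (f x)).
  move=> mf; apply: measurableT_comp mf; apply: continuous_measurable_fun.
  exact: continuous_cos.
have ms (f : X -> R) : measurable_fun setT f ->
    measurable_fun setT (fun x => sin (f x)).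
  move=> mf; apply: measurableT_comp mf; apply: continuous_measurable_fun.
  exact: continuous_sin.
have mN (f : X -> R) : measurable_fun setT f ->
    measurable_fun setT (fun x => - f x).
  by move=> mf; exact: measurable_funN.
have mR3 (f : X -> R) : measurable_fun setT f ->
    forall i j, measurable_fun setT (fun x => R3 (f x) i j).
  move=> mf i j; under eq_fun do rewrite mxE.
  case: i j => -[|[|[|//]]] hi [[|[|[|//]]] hj] /=;
    by [exact: measurable_cst|exact: mc|exact: ms|apply: mN; exact: ms].
have mR2 (f : X -> R) : measurable_fun setT f ->
    forall i j, measurable_fun setT (fun x => R2 (f x) i j).
  move=> mf i j; under eq_fun do rewrite mxE.
  case: i j => -[|[|[|//]]] hi [[|[|[|//]]] hj] /=;
    by [exact: measurable_cst|exact: mc|exact: ms|apply: mN; exact: ms].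
move=> ma mb mg; apply: measurable_mulmx; last exact: mR3.
by apply: measurable_mulmx; [exact: mR3|exact: mR2].
Qed.

Lemma measurable_zen : measurable_fun setT (@zen R).
Proof.
have -> : @zen R = fun x => acos_clip (val x 2%:R 0).
  apply/funext => x; have [-> _] := zenE x.
  by rewrite acos_clipE//; have := S2E x => h; apply/andP; split; nra.
apply: measurableT_comp; first exact: measurable_acos_clip.
exact: measurable_S2_coord.
Qed.

End borel_measurability.

Section surface_measure.
Context {R : realType}.
Local Open Scope ereal_scope.

(* the surface measure in spherical coordinates:
   d sigma (Phi (phi, theta)) = sin theta d theta d phi *)
Definition spherical_domain : set (R * R) :=
  `[0%R, (2 * pi)%R[ `*` `[0%R, pi].

Definition surface_measure (A : set (S2 R)) : \bar R :=
  \int[lebesgue_measure \x lebesgue_measure]_(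
    p in spherical_domain `&` (fun p => Phi p.1 p.2) @^-1` A) (sin p.2)%:E.

Lemma measurable_Phi :
  measurable_fun setT (fun p : R * R => Phi p.1 p.2).
Proof.
have mc1 : measurable_fun setT (fun p : R * R => cos p.1).
  by apply: measurableT_comp => //; apply: continuous_measurable_fun;
     exact: continuous_cos.
have mc2 : measurable_fun setT (fun p : R * R => cos p.2).
  by apply: measurableT_comp => //; apply: continuous_measurable_fun;
     exact: continuous_cos.
have ms1 : measurable_fun setT (fun p : R * R => sin p.1).
  by apply: measurableT_comp => //; apply: continuous_measurable_fun;
     exact: continuous_sin.
have ms2 : measurable_fun setT (fun p : R * R => sin p.2).
  by apply: measurableT_comp => //; apply: continuous_measurable_fun;
     exact: continuous_sin.
apply: measurable_to_S2 => -[[|[|[|//]]] hi].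
- rewrite (_ : (fun _ => _) = fun p : R * R => cos p.1 * sin p.2)%R.
    exact: measurable_funM.
  by apply/funext => p; rewrite PhiE mxE.
- rewrite (_ : (fun _ => _) = fun p : R * R => sin p.1 * sin p.2)%R.
    exact: measurable_funM.
  by apply/funext => p; rewrite PhiE mxE.
- rewrite (_ : (fun _ => _) = fun p : R * R => cos p.2)%R//.
  by apply/funext => p; rewrite PhiE mxE.
Qed.

Let measurable_sin2 D : measurable_fun D (fun p : R * R => (sin p.2)%:E).
Proof.
apply: measurable_funTS; apply/measurable_EFinP.
by apply: measurableT_comp => //; apply: continuous_measurable_fun;
   exact: continuous_sin.
Qed.

Lemma measurable_spherical_domain : measurable spherical_domain.
Proof. by apply: measurableX; exact: measurable_itv. Qed.

Let sin_ge0 p : spherical_domain p -> 0 <= (sin p.2)%:E.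
Proof.
by move=> [_ /=]; rewrite in_itv/= lee_fin => ?; rewrite sin_ge0_pi.
Qed.

Let surface_measure0 : surface_measure set0 = 0.
Proof. by rewrite /surface_measure preimage_set0 setI0 integral_set0. Qed.

Let surface_measure_ge0 A : 0 <= surface_measure A.
Proof. by apply: integral_ge0 => p [/sin_ge0]. Qed.

Let surface_measure_semi_sigma_additive : semi_sigma_additive surface_measure.
Proof.
move=> F mF tF mUF; rewrite /surface_measure preimage_bigcup setI_bigcupr.
pose G k := spherical_domain `&` (fun p => Phi p.1 p.2) @^-1` F k.
have mG k : measurable (G k).
  apply: measurableI; first exact: measurable_spherical_domain.
  by rewrite -[X in measurable X]setTI; exact: measurable_Phi.
have tG : trivIset setT G.
  apply/trivIsetP => i j _ _ ij; rewrite /G setIACA setIid -preimage_setI.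
  move/trivIsetP : tF => /(_ i j Logic.I Logic.I ij) ->.
  by rewrite preimage_set0 setI0.
have G0 p : (\bigcup_k G k) p -> 0 <= (sin p.2)%:E by move=> [k _ []] /sin_ge0.
rewrite [X in _ --> X](ge0_integral_bigcup
  (lebesgue_measure \x lebesgue_measure) mG (@measurable_sin2 _) G0 tG).
apply: is_cvg_ereal_nneg_natsum_cond => n _ _.
by apply: integral_ge0 => p [/sin_ge0].
Qed.

HB.instance Definition _ := isMeasure.Build _ _ _ surface_measure
  surface_measure0 surface_measure_ge0 surface_measure_semi_sigma_additive.

Lemma surface_measureT : surface_measure setT = (4 * pi)%:E.
Proof.
rewrite /surface_measure preimage_setT setIT.
have s0 (t : R) : t \in `[0%R, pi] -> (0 <= sin t)%R.
  by rewrite in_itv/=; exact: sin_ge0_pi.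
pose f (p : R * R) : \bar R := (\1_(`[0%R, (2 * pi)%R[ : set R) p.1)%:E *
     ((sin \_ `[0%R, pi]) p.2)%:E.
have msin : measurable_fun setT (sin \_ `[0%R, pi] : R -> R).
  apply/(measurable_restrictT _ _).1; first exact: measurable_itv.
  apply: measurable_funTS; apply: continuous_measurable_fun.
  exact: continuous_sin.
have mf : measurable_fun setT f.
  apply: emeasurable_funM; apply/measurable_EFinP.
    by apply: measurableT_comp => //; apply: measurable_indic.
  exact: measurableT_comp.
have g0 y : 0 <= ((sin \_ `[0%R, pi]) y)%:E :> \bar R.
  rewrite lee_fin /patch; case: ifPn => // /set_mem.
  exact: s0.
have f0 p : 0 <= f p by rewrite mule_ge0// lee_fin.
have -> : \int[lebesgue_measure \x lebesgue_measure]_(p in spherical_domain)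
    (sin p.2)%:E = \int[lebesgue_measure \x lebesgue_measure]_p f p.
  rewrite integral_mkcond; apply: eq_integral => p _.
  rewrite /f /patch/= indicE in_setX.
  case: (p.1 \in _); rewrite /= ?mul0e// mul1e.
  by case: ifP.
have I2 : \int[lebesgue_measure]_y ((sin \_ `[0%R, pi]) y)%:E = 2%:E :> \bar R.
  have -> : 2%:E = (- cos pi)%:E - (- cos 0)%:E :> \bar R.
    by rewrite cospi cos0 -EFinB; congr (_%:E); ring.
  rewrite -(@continuous_FTC2 _ sin (fun x => - cos x)%R)//.
  - rewrite [RHS]integral_mkcond; apply: eq_integral => y _.
    by rewrite /patch; case: ifP.
  - exact: pi_gt0.
  - by apply: continuous_subspaceT; exact: continuous_sin.
  - split.
    + by move=> x _; apply: derivableN; exact: derivable_cos.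
    + apply: cvg_at_right_filter; apply: cvgN; exact: continuous_cos.
    + apply: cvg_at_left_filter; apply: cvgN; exact: continuous_cos.
  - by move=> x _; rewrite derive1E deriveN ?derive_val ?opprK//.
have F1 x : fubini_F lebesgue_measure f x =
    (\1_(`[0%R, (2 * pi)%R[ : set R) x)%:E * 2%:E.
  rewrite -I2 /fubini_F -ge0_integralZl//.
  exact/measurable_EFinP.
rewrite fubini_tonelli1//.
transitivity (\int[lebesgue_measure]_x
    ((\1_(`[0%R, (2 * pi)%R[ : set R) x)%:E * 2%:E) : \bar R).
  by apply: eq_integral => x _; exact: F1.
have mI : measurable_fun setT (\1_(`[0%R, (2 * pi)%R[ : set R) : R -> R).
  exact: measurable_indic.
have mI' : measurable_fun setT
    (fun x : R => (\1_(`[0%R, (2 * pi)%R[ : set R) x)%:E : \bar R).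
  exact/measurable_EFinP.
rewrite ge0_integralZr//.
rewrite integral_indic// setIT.
transitivity ((2 * pi)%:E * 2%:E : \bar R).
  congr (_ * _); apply: (eq_trans (lebesgue_measure_itv `[0%R, (2 * pi)%R[)).
  by rewrite /= lte_fin mulr_gt0 ?pi_gt0// oppr0 adde0.
by rewrite -EFinM; congr (_%:E); ring.
Qed.

Let four_pi_ge0 : (0 <= (4 * pi)^-1 :> R)%R.
Proof. by rewrite invr_ge0 mulr_ge0// pi_ge0. Qed.

Definition uniform_S2 : set (S2 R) -> \bar R :=
  mscale (NngNum four_pi_ge0) surface_measure.

HB.instance Definition _ := Measure.on uniform_S2.

Let uniform_S2T : uniform_S2 setT = 1.
Proof.
rewrite /uniform_S2 /mscale /= surface_measureT -EFinM mulVf//.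
by rewrite lt0r_neq0// mulr_gt0// pi_gt0.
Qed.

HB.instance Definition _ :=
  Measure_isProbability.Build _ _ _ uniform_S2 uniform_S2T.

End surface_measure.

Section product_charge.
Context d1 d2 (T1 : measurableType d1) (T2 : measurableType d2) (R : realType).
Variables (m : {finite_measure set T1 -> \bar R}).
Variable nu : {charge set T2 -> \bar R}.
Local Open Scope ereal_scope.

(* \x is only known to be a measure for two measures, but its definition as an
   iterated integral makes sense for a signed second factor; product_chargeE
   relates it to a Jordan decomposition. *)
Definition product_charge : set (T1 * T2) -> \bar R := m \x nu.

Let jordan : exists p n : {finite_measure set T2 -> \bar R},
  forall A, measurable A -> nu A = p A - n A.
Proof.
have [P [N nuPN]] := Hahn_decomposition nu.
exists (jordan_pos nuPN), (jordan_neg nuPN) => A mA.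
by rewrite (jordan_decomp nuPN)// /cadd /=; congr (_ + _)%E; exact: mulN1e.
Qed.

Lemma product_chargeE (p n : {finite_measure set T2 -> \bar R}) :
  (forall A, measurable A -> nu A = p A - n A) ->
  forall A, measurable A -> product_charge A = (m \x p) A - (m \x n) A.
Proof.
move=> pn A mA; rewrite /product_charge /product_measure1.
have itg (q : {finite_measure set T2 -> \bar R}) :
    m.-integrable setT (q \o xsection A).
  apply: (@le_integrable _ _ _ m setT measurableT _ (cst (q setT))).
  - exact: measurable_fun_xsection.
  - move=> x _ /=; rewrite !gee0_abs// le_measure// inE//.
    exact: measurable_xsection.
  - have qT : q setT \is a fin_num by rewrite fin_num_measure.
    by rewrite -(fineK qT); exact: finite_measure_integrable_cst.
rewrite -integralB//; apply: eq_integral => x _ /=.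
by rewrite pn//; exact: measurable_xsection.
Qed.

Let product_fin (q : {finite_measure set T2 -> \bar R}) A :
  measurable A -> (m \x q) A \is a fin_num.
Proof.
move=> mA; rewrite ge0_fin_numE//.
apply: (@le_lt_trans _ _ ((m \x q) setT)).
  by apply: le_measure => //; rewrite inE.
rewrite -setXTT product_measure1E//.
by rewrite lte_mul_pinfty// ?fin_num_measure// -ge0_fin_numE// fin_num_measure.
Qed.

Let product_charge0 : product_charge set0 = 0.
Proof.
by rewrite /product_charge /product_measure1 integral0_eq// => x _ /=;
   rewrite xsection0 charge0.
Qed.

Let product_charge_finite A : measurable A -> product_charge A \is a fin_num.
Proof.
move=> mA; have [p [n pn]] := jordan.
by rewrite (product_chargeE pn)// fin_numB !product_fin.
Qed.

Let product_charge_semi_sigma_additive : semi_sigma_additive product_charge.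
Proof.
have [p [n pn]] := jordan => F mF tF mUF.
rewrite (product_chargeE pn)//.
under eq_fun do under eq_bigr do rewrite (product_chargeE pn)//.
have -> : (fun k => \sum_(0 <= i < k) ((m \x p) (F i) - (m \x n) (F i))) =
    (fun k => \sum_(0 <= i < k) (m \x p) (F i) -
              \sum_(0 <= i < k) (m \x n) (F i)).
  apply/funext => k; rewrite -fin_num_sumeN; last by move=> i _; exact: product_fin.
  by rewrite -big_split.
apply: cvgeB.
- by rewrite fin_num_adde_defl// fin_numN product_fin.
- exact: measure_semi_sigma_additive.
- exact: measure_semi_sigma_additive.
Qed.

HB.instance Definition _ := isCharge.Build _ _ _ product_charge
  product_charge0 product_charge_finite product_charge_semi_sigma_additive.

End product_charge.

Section semicircle.
Context {R : realType}.

Definition T_W (p : S2 R * S2 R) : SO3 R :=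
  let a := azi p.1 in let b := zen p.1 in Psi a b (azimuth_op a b p.2).

Lemma measurable_T_W : measurable_fun setT T_W.
Proof.
have ma : measurable_fun setT (fun p : S2 R * S2 R => azi p.1).
  apply: measurable_azi => i.
  by apply: (measurableT_comp (measurable_S2_coord i)); exact: measurable_fst.
have mb : measurable_fun setT (fun p : S2 R * S2 R => zen p.1).
  by apply: (measurableT_comp measurable_zen); exact: measurable_fst.
apply: measurable_to_SO3; apply: measurable_Psi_mx => //.
apply: measurable_azi => i.
apply: (measurable_mulmx
  (A := fun p : S2 R * S2 R => (Psi_mx (azi p.1) (zen p.1) 0)^T)
  (B := fun p : S2 R * S2 R => val p.2)) => {i} i j.
  under eq_fun do rewrite mxE.
  by apply: measurable_Psi_mx => //; exact: measurable_cst.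
rewrite ord1; apply: (measurableT_comp (measurable_S2_coord i)).
exact: measurable_snd.
Qed.

Definition semicircle_fun (mu : {charge set (S2 R) -> \bar R}) :
    set (SO3 R) -> \bar R :=
  pushforward (product_charge uniform_S2 mu) T_W.

Section semicircle_charge.
Variable mu : {charge set (S2 R) -> \bar R}.

Let mT_W A : measurable A -> measurable (T_W @^-1` A).
Proof. by move=> mA; rewrite -[X in measurable X]setTI; exact: measurable_T_W. Qed.

Let semicircle0 : semicircle_fun mu set0 = 0%E.
Proof. by rewrite /semicircle_fun /pushforward preimage_set0 charge0. Qed.

Let semicircle_finite A : measurable A -> semicircle_fun mu A \is a fin_num.
Proof.
move=> mA; rewrite /semicircle_fun /pushforward.
by apply: fin_num_measure; exact: mT_W.
Qed.

Let semicircle_semi_sigma_additive : semi_sigma_additive (semicircle_fun mu).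
Proof.
move=> F mF tF mUF; rewrite /semicircle_fun /pushforward preimage_bigcup.
apply: charge_semi_sigma_additive.
- by move=> n; exact: mT_W.
- apply/trivIsetP => i j _ _ ij; rewrite -preimage_setI.
  by move/trivIsetP : tF => /(_ _ _ Logic.I Logic.I ij) ->; rewrite preimage_set0.
- by rewrite -preimage_bigcup; exact: mT_W.
Qed.

HB.instance Definition _ := isCharge.Build _ _ _ (semicircle_fun mu)
  semicircle0 semicircle_finite semicircle_semi_sigma_additive.

End semicircle_charge.

Definition semicircle_transform (mu : {charge set (S2 R) -> \bar R}) :
  {charge set (SO3 R) -> \bar R} := semicircle_fun mu.

End semicircle.

(* Main.v *)
Require Import Defs.
From HB Require Import structures.
From mathcomp Require Import all_boot all_order all_algebra.
From mathcomp Require Import all_classical all_reals all_analysis.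
From mathcomp Require Import measurable_realfun.
From mathcomp Require Import complex zify ring lra.

(** Decomposing both charges into differences of finite measures reduces the
claim to finite measures [p], [q] on the sphere such that [u x p] and [u x q]
have the same image under [T_W], where [u] is the uniform measure
([nonnegative_injectivity]).

For [xi] other than [eta] and [- eta], the frame [Q = T_W (eta, xi)] is
characterised by [Q e3 = eta] and by [xi] lying on the open half circle from [eta]
to [- eta] through [Q e1].  Since [Q] determines [eta], every integral
of a function of [Q] can be localised at the pole [eta], and for each bounded [F]
and almost every [eta] the measures [p] and [q] give the same
integral to [xi |-> F (T_W (eta, xi))].  The functions used are
[F Q = Re (<Q e1 + i Q e2, y> ^ n)]; in terms of [eta] and [xi] they are given by
[zkernel], which only involves scalar products and is continuous in [eta] as
long as [eta] is not [xi] or [- xi].  So equality almost everywhere extends to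
every [eta] off the great circle through the poles on which the spherical
coordinates degenerate, unless [eta] or [- eta] is an atom of [p] or [q]
([agree_off_atoms]).

This makes it possible to integrate over [eta] against any measure on the sphere
for which great circles are null.  The measure chosen is [cone_measure], the
image of the Lebesgue measure of the unit ball under [x |-> x / |x|]: it is invariant under rotations
because a plane rotation is a product of three shears.  The integral of
[zkernel n y eta xi] over [eta] then depends on [<xi, y>] only.  With [xi] moved
to the north pole, [y] can be averaged over the rotations about the axis by the
multiples of [2 pi / (n + 1)], and this average extracts the middle coefficient
of the [n]-th power of a trinomial ([sum_root_trinomial]).  Since [Q e1 + i Q e2]
is isotropic, the outcome is [sin ^ n] of the angle between [eta] and [xi] times
the Legendre polynomial [zonal n] at [<xi, y>].  Therefore [p] and [q] give the
same integral to [c_n * zonal n <xi, y>] with [c_n > 0], for all [n] and [y]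
([Rintegral_zkernel], [zonal_factor_gt0]).  It is essential that no degree, even
or odd, is lost here.

As [zonal n] has degree [n], the integrals of all powers [<xi, y> ^ n] agree,
hence those of the exponentials of all linear forms.  Exponentials are stable
under products and generate, through bounded pointwise limits of the functions
[(1 - s ^ m) ^ (m K ^ m)] of [s = exp (xi_i - a) / K], the indicator functions of
the boxes [xi_i < a_i], which form a pi-system ([zonal_moments_determine]). *)

Set Implicit Arguments.
Unset Strict Implicit.
Unset Printing Implicit Defensive.

Import Order.TTheory GRing.Theory Num.Theory.
Import numFieldNormedType.Exports.

Local Open Scope classical_set_scope.
Local Open Scope ring_scope.

(** * Invariance of the plane Lebesgue measure under rotations *)

Section lebesgue_invariance.
Context {R : realType}.
Local Notation lam := (@lebesgue_measure R).
Local Open Scope ereal_scope.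

(** The name carries the sigma-finiteness, which Tonelli's theorem in space uses
for the product of the plane and a line. *)
Definition plane_measure : set (measurableTypeR R * measurableTypeR R) -> \bar R :=
  lam \x lam.

HB.instance Definition _ := Measure.on plane_measure.

Let plane_measure_sigma_finite : sigma_finite setT plane_measure.
Proof.
pose I n : set R := `[(- n%:R)%R, n%:R%R]%classic.
have mI n : measurable (I n) by exact: measurable_itv.
exists (fun n => I n `*` I n) => [|n].
  apply/seteqP; split => // -[x y] _; pose m := (Num.trunc (`|x| + `|y|)).+1.
  have xym : (`|x| + `|y| < m%:R)%R by apply: truncnS_gt.
  exists m => //=; rewrite /I/= !in_itv/= -!ler_norml.
  have := normr_ge0 x; have := normr_ge0 y; lra.
split; first by apply: measurableX; exact: mI.
have In : lam (I n) < +oo.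
  by rewrite lebesgue_measure_itv/=; case: ifP => _; rewrite ?ltry.
rewrite /plane_measure product_measure1E; [|exact: mI|exact: mI].
by rewrite lte_mul_pinfty// ge0_fin_numE.
Qed.

HB.instance Definition _ :=
  Measure_isSigmaFinite.Build _ _ _ plane_measure plane_measure_sigma_finite.

Local Notation lam2 := plane_measure.

Lemma ge0_integral_translation (f : R -> \bar R) (a : R) :
  measurable_fun setT f -> (forall x, 0 <= f x) ->
  \int[lam]_x f (x + a)%R = \int[lam]_x f x.
Proof.
move=> mf f0; pose T := measurableTypeR R.
have ma : measurable_fun setT (fun x : T => (x + a)%R : T).
  by apply: measurable_funD => //; exact: measurable_cst.
rewrite -[LHS](@ge0_integral_pushforward _ _ _ _ _ _ ma lam setT f)//.
apply: eq_measure_integral => A mA _; apply/esym.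
apply: (@lebesgue_measure_unique _ (measure_function_pushforward__canonical__measure_function_Measure lam ma)) => // _ [[b c] /= _ <-].
rewrite /pushforward.
have -> : (fun x : T => (x + a)%R) @^-1` `]b, c]%classic = `](b - a)%R, (c - a)%R]%classic.
  by apply/seteqP; split => x /=; rewrite !in_itv/= ltrBlDr lerBrDr.
rewrite !lebesgue_measure_itv/= !lte_fin ltrD2r; case: ifP => // _.
by rewrite -!EFinB; congr (_%:E); ring.
Qed.

Lemma ge0_integral_shear1 (f : R * R -> \bar R) (t : R) :
  measurable_fun setT f -> (forall x, 0 <= f x) ->
  \int[lam2]_p f (p.1 + t * p.2, p.2)%R = \int[lam2]_p f p.
Proof.
move=> mf f0; rewrite /plane_measure.
rewrite !fubini_tonelli2//.
  apply: eq_integral => y _; rewrite /fubini_G /=.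
  rewrite (ge0_integral_translation (f := fun x => f (x, y)))//.
  exact: measurableT_comp.
apply: measurableT_comp => //; apply: measurable_fun_pair => //=.
by apply: measurable_funD => //; apply: measurable_funM.
Qed.

Lemma ge0_integral_shear2 (f : R * R -> \bar R) (t : R) :
  measurable_fun setT f -> (forall x, 0 <= f x) ->
  \int[lam2]_p f (p.1, p.2 + t * p.1)%R = \int[lam2]_p f p.
Proof.
move=> mf f0; rewrite /plane_measure.
rewrite !fubini_tonelli1//.
  apply: eq_integral => y _; rewrite /fubini_F /=.
  rewrite (ge0_integral_translation (f := fun x => f (y, x)))//.
  exact: measurableT_comp.
apply: measurableT_comp => //; apply: measurable_fun_pair => //=.
by apply: measurable_funD => //; apply: measurable_funM.
Qed.

Lemma measurable_fun_linear2 (a b c d : R) : measurable_fun [set: R * R]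
  (fun p : R * R => (a * p.1 + b * p.2, c * p.1 + d * p.2)%R).
Proof.
by apply: measurable_fun_pair;
  apply: measurable_funD; apply: measurable_funM => //; exact: measurable_cst.
Qed.

(** With [t = - s / (1 + c) = - tan (angle / 2)] the rotation is the shear
[x += t y], followed by [y += s x], followed by [x += t y].  This fails only for
[c = -1], the half turn, which is the square of a quarter turn. *)
Lemma ge0_integral_rotation2 (f : R * R -> \bar R) (c s : R) :
  (c ^+ 2 + s ^+ 2 = 1)%R -> measurable_fun setT f -> (forall x, 0 <= f x) ->
  \int[lam2]_p f (c * p.1 - s * p.2, s * p.1 + c * p.2)%R = \int[lam2]_p f p.
Proof.
have rot (c0 s0 : R) (g : R * R -> \bar R) :
    (c0 ^+ 2 + s0 ^+ 2 = 1)%R -> (c0 != -1)%R ->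
    measurable_fun setT g -> (forall x, 0 <= g x) ->
    \int[lam2]_p g (c0 * p.1 - s0 * p.2, s0 * p.1 + c0 * p.2)%R =
    \int[lam2]_p g p.
  move=> cs c1 mg g0; have c1' : (1 + c0 != 0)%R.
    by apply: contra c1; rewrite addrC addr_eq0.
  pose t := (- s0 / (1 + c0))%R.
  pose h1 p := g (p.1 + t * p.2, p.2)%R.
  pose h2 p := h1 (p.1, p.2 + s0 * p.1)%R.
  have mh1 : measurable_fun setT h1.
    apply: measurableT_comp => //; have := measurable_fun_linear2 1 t 0 1.
    by apply: eq_measurable_fun => p _; rewrite !mul1r mul0r add0r.
  have mh2 : measurable_fun setT h2.
    apply: measurableT_comp => //; have := measurable_fun_linear2 1 0 s0 1.
    by apply: eq_measurable_fun => p _; rewrite !mul1r mul0r addr0 addrC.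
  have h10 p : 0 <= h1 p by exact: g0.
  have h20 p : 0 <= h2 p by exact: h10.
  rewrite -(ge0_integral_shear1 t mg g0) -(ge0_integral_shear2 s0 mh1 h10).
  rewrite -(ge0_integral_shear1 t mh2 h20).
  apply: eq_integral => p _; rewrite /h2 /h1 /=.
  have ts : (t * s0 = c0 - 1)%R.
    rewrite /t mulrAC mulNr -expr2 (_ : s0 ^+ 2 = (1 - c0) * (1 + c0))%R.
      by rewrite -mulNr mulfK// opprB.
    by lra.
  have tc : (t * (1 + c0) = - s0)%R by rewrite /t mulfVK.
  congr (g (_, _)).
    transitivity ((1 + t * s0) * p.1 + ((1 + t * s0) * t + t) * p.2)%R; last by ring.
    rewrite ts (_ : (1 + (c0 - 1)) * t + t = t * (1 + c0))%R; last by ring.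
    by rewrite tc; ring.
  transitivity (s0 * p.1 + (1 + t * s0) * p.2)%R; last by ring.
  by rewrite ts; ring.
move=> cs mf f0; have [c1|c1] := eqVneq c (-1)%R; last exact: rot.
have s0 : (s = 0)%R by apply/eqP; rewrite -sqrf_eq0 -(subrr 1%R) -{1}cs c1; apply/eqP; ring.
have m1 : (0 != -1 :> R)%R by rewrite eq_sym oppr_eq0 oner_eq0.
have q1 : (0 ^+ 2 + 1 ^+ 2 = 1 :> R)%R by ring.
pose h p := f (0 * p.1 - 1 * p.2, 1 * p.1 + 0 * p.2)%R.
have mh : measurable_fun setT h.
  apply: measurableT_comp => //; have := measurable_fun_linear2 0 (-1) 1 0.
  by apply: eq_measurable_fun => p _; rewrite mulN1r !mul1r.
rewrite -(rot 0%R 1%R f q1 m1 mf f0) -(rot 0%R 1%R h q1 m1 mh); last first.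
  by move=> p; exact: f0.
by apply: eq_integral => p _ /=; rewrite c1 s0 /h/=; congr (f (_, _)); ring.
Qed.

End lebesgue_invariance.

(** * A rotation invariant measure on the sphere *)

Section sphere_rotations.
Context {R : realType}.
Implicit Types (x y z : S2 R) (a b c : R).

Definition dot x y : R := ((val x)^T *m val y) 0 0.

Lemma dotE x y : dot x y =
  val x 0 0 * val y 0 0 + val x 1 0 * val y 1 0 + val x 2%:R 0 * val y 2%:R 0.
Proof.
rewrite /dot mxE !big_ord_recl big_ord0 addr0 addrA !mxE.
by congr (_ * _ + _ * _ + _ * _); congr (fun_of_matrix _ _ _); exact: val_inj.
Qed.

Lemma dotC x y : dot x y = dot y x.
Proof. by rewrite !dotE; ring. Qed.

Lemma dotxx x : dot x x = 1.
Proof. by rewrite dotE -(S2E x); ring. Qed.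

Lemma dot_rotT (A : SO3 R) x y : dot (rotT A x) (rotT A y) = dot x y.
Proof.
rewrite /dot /= trmx_mul trmxK -mulmxA (mulmxA (val A)).
by have [/mulmx1C-> _] := SO3P A; rewrite mul1mx.
Qed.

Lemma R3_0 : R3 0 = 1%:M :> 'M[R]_3.
Proof.
by apply/matrixP => -[[|[|[|//]]] hi] [[|[|[|//]]] hj];
  rewrite !mxE/= ?cos0 ?sin0 ?oppr0.
Qed.

Lemma R2_0 : R2 0 = 1%:M :> 'M[R]_3.
Proof.
by apply/matrixP => -[[|[|[|//]]] hi] [[|[|[|//]]] hj];
  rewrite !mxE/= ?cos0 ?sin0 ?oppr0.
Qed.

Lemma rotT_Psi a b c x :
  rotT (Psi a b c) x = rotT (Psi c 0 0) (rotT (Psi 0 b 0) (rotT (Psi a 0 0) x)).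
Proof.
apply/val_inj; rewrite /= /Psi_mx R3_0 R2_0 !mulmx1 !mul1mx.
by rewrite !trmx_mul !mulmxA.
Qed.

Lemma measurable_rotT (A : SO3 R) : measurable_fun setT (rotT A).
Proof.
apply: measurable_to_S2 => i /=.
apply: (measurable_mulmx (A := fun=> (val A)^T) (B := fun x : S2 R => val x)).
  by move=> k j; exact: measurable_cst.
by move=> k j; rewrite ord1; exact: measurable_S2_coord.
Qed.

Lemma measurable_dot d (T : measurableType d) (f g : T -> S2 R) :
  measurable_fun setT f -> measurable_fun setT g ->
  measurable_fun setT (fun t => dot (f t) (g t)).
Proof.
move=> mf mg; under eq_fun do rewrite dotE.
have mc i (h : T -> S2 R) : measurable_fun setT h ->
    measurable_fun setT (fun t => val (h t) i 0).
  by move=> mh; apply: (measurableT_comp (measurable_S2_coord i)).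
by apply: measurable_funD; [apply: measurable_funD|]; apply: measurable_funM; exact: mc.
Qed.

End sphere_rotations.

Section cone_measure.
Context {R : realType}.
Local Notation lam := (@lebesgue_measure R).
Local Notation lam2 := (@plane_measure R).
Local Notation lam3 := (lam2 \x lam)%E.
Implicit Types (v : R * R * R) (a b c s : R).

Lemma lebesgue_box (I J K : set R) : measurable I -> measurable J ->
  measurable K -> lam3 ((I `*` J) `*` K) = (lam I * lam J * lam K)%E.
Proof.
move=> mI mJ mK; have mIJ : measurable (I `*` J) by exact: measurableX.
transitivity (lam2 (I `*` J) * lam K)%E; first exact: product_measure1E.
by congr (_ * _)%E; rewrite /plane_measure product_measure1E.
Qed.

Definition sqnorm3 v : R := v.1.1 ^+ 2 + v.1.2 ^+ 2 + v.2 ^+ 2.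

Definition vec3 v : 'cV[R]_3 := \col_i [:: v.1.1; v.1.2; v.2]`_i.

(** The origin is not sent to a direction, and gets an arbitrary one. *)
Definition radial v : S2 R :=
  insubd (Phi 0 0) ((Num.sqrt (sqnorm3 v))^-1 *: vec3 v).

Definition punctured_ball : set (R * R * R) := [set v | 0 < sqnorm3 v <= 1].

Lemma radialE v : 0 < sqnorm3 v ->
  val (radial v) = (Num.sqrt (sqnorm3 v))^-1 *: vec3 v.
Proof.
move=> v0; rewrite val_insubd ifT//; apply/mem_set.
rewrite /sphere_set /= !big_ord_recl big_ord0 addr0 !mxE /= !exprMn -!mulrDr.
rewrite exprVn sqr_sqrtr ?ltW// addrA -/(sqnorm3 v) mulVf//.
by rewrite gt_eqF.
Qed.

Lemma rotT_radial (A : SO3 R) v w : vec3 w = (val A)^T *m vec3 v ->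
  sqnorm3 w = sqnorm3 v -> 0 < sqnorm3 v -> rotT A (radial v) = radial w.
Proof.
move=> wE nE v0; apply: val_inj; rewrite /= !radialE ?nE// wE.
by rewrite scalemxAr.
Qed.

Lemma radial_degenerate v : ~~ (0 < sqnorm3 v) -> radial v = Phi 0 0.
Proof.
move=> v0; apply: val_inj; rewrite val_insubd ifF//; apply/negbTE/negP.
move=> /set_mem; rewrite -leNgt in v0.
rewrite /sphere_set /= ler0_sqrtr// invr0 scale0r.
rewrite big1; last by move=> i _; rewrite mxE expr0n.
by move=> /esym/eqP; rewrite oner_eq0.
Qed.

Lemma measurable_vec3 i : measurable_fun setT (fun v => vec3 v i 0).
Proof.
under eq_fun do rewrite mxE.
case: i => -[|[|[|//]]] hi /=.
- exact: (measurableT_comp measurable_fst measurable_fst).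
- exact: (measurableT_comp measurable_snd measurable_fst).
- exact: measurable_snd.
Qed.

Lemma measurable_sqnorm3 : measurable_fun setT sqnorm3.
Proof.
have m i : measurable_fun setT (fun v => vec3 v i 0 ^+ 2).
  by apply: measurable_funX; exact: measurable_vec3.
have := measurable_funD (measurable_funD (m 0) (m 1)) (m 2%:R).
by apply: eq_measurable_fun => v _ /=; rewrite !mxE.
Qed.

Lemma measurable_radial : measurable_fun setT radial.
Proof.
apply: measurable_to_S2 => i.
have -> : (fun v => val (radial v) i 0) = (fun v => if 0 < sqnorm3 v then
    Num.sqrt (sqnorm3 v) `^ (-1) * vec3 v i 0 else val (@Phi R 0 0) i 0).
  apply/funext => v; case: ifPn => v0; last by rewrite radial_degenerate.
  by rewrite radialE// mxE powR_inv1// sqrtr_ge0.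
apply: measurable_fun_ifT => //.
- by apply: measurable_fun_ltr => //; exact: measurable_sqnorm3.
- apply: measurable_funM; last exact: measurable_vec3.
  apply: (measurableT_comp (measurable_powR (-1))).
  apply: measurableT_comp; last exact: measurable_sqnorm3.
  by apply: continuous_measurable_fun; exact: sqrt_continuous.
Qed.

Lemma measurable_punctured_ball : measurable punctured_ball.
Proof.
rewrite -[X in measurable X]setTI; have := measurable_sqnorm3.
by move=> /(_ measurableT `]0, 1]%classic (measurable_itv _)).
Qed.

Lemma punctured_ball_lty : (lam3 punctured_ball < +oo)%E.
Proof.
pose I : set R := `[(-1), 1]%classic.
have mI : measurable I by exact: measurable_itv.
have lI : (lam I < +oo)%E.
  by rewrite /I lebesgue_measure_itv/=; case: ifP => _; rewrite ?ltry.
apply: (@le_lt_trans _ _ (lam3 ((I `*` I) `*` I))).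
  apply: le_measure; rewrite ?inE.
  - exact: measurable_punctured_ball.
  - by apply: measurableX => //; exact: measurableX.
  - move=> v; rewrite /punctured_ball/= => /andP[_ v1].
    rewrite /sqnorm3 in v1; rewrite /I/= !in_itv/=.
    by split; [split|]; apply/andP; split; nra.
rewrite lebesgue_box//.
by rewrite !lte_mul_pinfty// ?mule_ge0// ge0_fin_numE// ?mule_ge0// lte_mul_pinfty// ge0_fin_numE.
Qed.

Definition cone_measure (A : set (S2 R)) : \bar R :=
  lam3 (radial @^-1` A `&` punctured_ball).

Lemma measurable_cone A : measurable A ->
  measurable (radial @^-1` A `&` punctured_ball).
Proof.
move=> mA; apply: measurableI; last exact: measurable_punctured_ball.
by rewrite -[X in measurable X]setTI; exact: measurable_radial.
Qed.

Let cone_measure0 : cone_measure set0 = 0%E.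
Proof. by rewrite /cone_measure preimage_set0 set0I measure0. Qed.

Let cone_measure_ge0 A : (0 <= cone_measure A)%E.
Proof. exact: measure_ge0. Qed.

Let cone_measure_semi_sigma_additive : semi_sigma_additive cone_measure.
Proof.
move=> F mF tF mUF; rewrite /cone_measure preimage_bigcup setI_bigcupl.
apply: measure_semi_sigma_additive.
- by move=> n; exact: measurable_cone.
- apply/trivIsetP => i j _ _ ij; rewrite setIACA setIid -preimage_setI.
  move/trivIsetP : tF => /(_ i j Logic.I Logic.I ij) ->.
  by rewrite preimage_set0 set0I.
- by rewrite -setI_bigcupl -preimage_bigcup; exact: measurable_cone.
Qed.

HB.instance Definition _ := isMeasure.Build _ _ _ cone_measure
  cone_measure0 cone_measure_ge0 cone_measure_semi_sigma_additive.

Let cone_measure_fin : fin_num_fun cone_measure.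
Proof.
move=> A mA; rewrite ge0_fin_numE//; apply: le_lt_trans punctured_ball_lty.
rewrite /cone_measure; apply: le_measure; last exact: subIsetr.
  by apply/mem_set; exact: measurable_cone.
by apply/mem_set; exact: measurable_punctured_ball.
Qed.

HB.instance Definition _ :=
  Measure_isFinite.Build _ _ _ cone_measure cone_measure_fin.

Lemma cone_measure_gt0 : (0 < cone_measure setT)%E.
Proof.
rewrite /cone_measure preimage_setT setTI.
pose I : set R := `[4^-1, 2^-1]%classic.
have mI : measurable I by exact: measurable_itv.
have lI : (lam I = 4^-1%:E)%E.
  rewrite /I lebesgue_measure_itv/= lte_fin ifT; last by lra.
  by rewrite -EFinB; congr (_%:E); lra.
apply: (@lt_le_trans _ _ (lam3 ((I `*` I) `*` I))).
  by rewrite lebesgue_box// lI !mule_gt0// lte_fin; lra.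
apply: le_measure; rewrite ?inE.
- by apply: measurableX => //; exact: measurableX.
- exact: measurable_punctured_ball.
- move=> v; rewrite /I/= !in_itv/= => -[[/andP[? ?] /andP[? ?]] /andP[? ?]].
  by rewrite /punctured_ball/= /sqnorm3; apply/andP; split; nra.
Qed.

(** The great circle in the plane [y = 0] is null.  By invariance so are all great
circles, and in particular the measure has no atoms. *)
Lemma cone_measure_meridian : cone_measure [set x : S2 R | val x 1 0 = 0] = 0%E.
Proof.
have mE : measurable ((setT `*` [set 0]) `*` setT : set (R * R * R)).
  by apply: measurableX => //; apply: measurableX.
apply/eqP; rewrite eq_le measure_ge0 andbT /cone_measure.
apply: (@le_trans _ _ (lam3 ((setT `*` [set 0]) `*` setT))); last first.
  by rewrite lebesgue_box// lebesgue_measure_set1 mule0 mul0e.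
apply: le_measure; rewrite ?inE//.
  apply: measurableI; last exact: measurable_punctured_ball.
  rewrite -[X in measurable X]setTI; apply: measurable_radial => //.
  by have := @measurable_S2_coord R 1 measurableT [set 0] (measurable_set1 0);
    rewrite setTI.
move=> v [/= r1 /andP[v0 _]]; split => //; split => //=.
move: r1; rewrite radialE// !mxE/= => /eqP.
rewrite mulf_eq0 invr_eq0 sqrtr_eq0 leNgt v0/= => /eqP.
by [].
Qed.

Lemma ge0_integral_lebesgue3 (f : R * R * R -> \bar R) :
  measurable_fun setT f -> (forall v, 0 <= f v)%E ->
  (\int[lam3]_v f v = \int[lam]_z \int[lam2]_p f (p, z))%E.
Proof.
move=> mf f0; have h := @fubini_tonelli2 _ _ _ _ R lam2 lam f mf f0.
by etransitivity; last exact: h.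
Qed.

Lemma ge0_integral_lebesgue3_iter (f : R * R * R -> \bar R) :
  measurable_fun setT f -> (forall v, 0 <= f v)%E ->
  (\int[lam3]_v f v = \int[lam]_x \int[lam]_y \int[lam]_z f ((x, y), z))%E.
Proof.
move=> mf f0; pose g p := (\int[lam]_z f (p, z))%E.
have mg : measurable_fun setT g.
  exact: (@measurable_fun_fubini_tonelli_F _ _ _ _ R lam f mf f0).
have g0 p : (0 <= g p)%E by apply: integral_ge0.
have h := @fubini_tonelli1 _ _ _ _ R lam2 lam f mf f0.
have h' := @fubini_tonelli1 _ _ _ _ R lam lam g mg g0.
etransitivity; last exact: h'.
by etransitivity; last exact: h.
Qed.

Lemma ge0_integral_rotation12 (f : R * R * R -> \bar R) c s :
  c ^+ 2 + s ^+ 2 = 1 -> measurable_fun setT f -> (forall v, 0 <= f v)%E ->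
  (\int[lam3]_v f ((c * v.1.1 - s * v.1.2, s * v.1.1 + c * v.1.2)%R, v.2) =
   \int[lam3]_v f v)%E.
Proof.
move=> cs mf f0; rewrite [RHS](ge0_integral_lebesgue3 mf f0).
pose g v := f ((c * v.1.1 - s * v.1.2, s * v.1.1 + c * v.1.2)%R, v.2).
have mg : measurable_fun setT g.
  apply: measurableT_comp => //; apply: measurable_fun_pair => //=.
  apply: (@measurableT_comp _ _ _ _ _ _ (fun p : R * R =>
    (c * p.1 - s * p.2, s * p.1 + c * p.2))); last exact: measurable_fst.
  have := measurable_fun_linear2 c (- s) s c.
  by apply: eq_measurable_fun => p _; rewrite mulNr.
have g0 v : (0 <= g v)%E by exact: f0.
transitivity (\int[lam3]_v g v)%E; first by apply: eq_integral.
rewrite (ge0_integral_lebesgue3 mg g0).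
apply: eq_integral => z _.
apply: (ge0_integral_rotation2 (f := fun p => f (p, z)) cs) => //.
exact: measurableT_comp.
Qed.

Lemma ge0_integral_swap23 (f : R * R * R -> \bar R) :
  measurable_fun setT f -> (forall v, 0 <= f v)%E ->
  (\int[lam3]_v f ((v.1.1, v.2), v.1.2) = \int[lam3]_v f v)%E.
Proof.
move=> mf f0; pose g v := f ((v.1.1, v.2), v.1.2).
have mg : measurable_fun setT g.
  apply: measurableT_comp => //; apply: measurable_fun_pair => /=.
    apply: measurable_fun_pair => //.
    exact: (measurableT_comp measurable_fst measurable_fst).
  exact: (measurableT_comp measurable_snd measurable_fst).
have g0 v : (0 <= g v)%E by exact: f0.
transitivity (\int[lam3]_v g v)%E; first by apply: eq_integral.
rewrite (ge0_integral_lebesgue3_iter mg g0) (ge0_integral_lebesgue3_iter mf f0).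
apply: eq_integral => x _.
apply: (fubini_tonelli (m1 := lam) (m2 := lam) (fun q => f ((x, q.2), q.1))) => //.
apply: measurableT_comp => //; apply: measurable_fun_pair => //=.
exact: measurable_fun_pair.
Qed.

(** It suffices to rotate the ball: [radial] commutes with rotations. *)
Lemma cone_measure_invariant (A : SO3 R) (h : R * R * R -> R * R * R) B :
  measurable_fun setT h ->
  (forall f, measurable_fun setT f -> (forall v, 0 <= f v)%E ->
     \int[lam3]_v f (h v) = \int[lam3]_v f v)%E ->
  (forall v, sqnorm3 (h v) = sqnorm3 v) ->
  (forall v, vec3 (h v) = (val A)^T *m vec3 v) ->
  measurable B -> cone_measure (rotT A @^-1` B) = cone_measure B.
Proof.
move=> mh hint hn hv mB; rewrite /cone_measure.
set D := radial @^-1` B `&` punctured_ball.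
have mD : measurable D by exact: measurable_cone.
have mhD : measurable (h @^-1` D).
  by rewrite -[X in measurable X]setTI; exact: mh.
have -> : radial @^-1` (rotT A @^-1` B) `&` punctured_ball = h @^-1` D.
  apply/seteqP; rewrite /D; split => v /=; rewrite /punctured_ball /= hn.
    by move=> [Bv /andP[v0 v1]]; rewrite -(rotT_radial (hv v))// v0.
  by move=> [Bv /andP[v0 v1]]; rewrite (rotT_radial (hv v))// v0.
have lamE E : measurable E -> (lam3 E = \int[lam3]_v (\1_E v)%:E)%E.
  by move=> mE; rewrite integral_indic// setIT.
rewrite (lamE _ mhD) (lamE _ mD).
rewrite -(hint (fun v => (\1_D v)%:E))//.
by apply/measurable_EFinP; exact: measurable_indic.
Qed.

(** Euler angles reduce this to rotations about two axes, and the one about the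
second axis is the one about the third up to a permutation of coordinates. *)
Lemma cone_measure_rotT a b c B : measurable B ->
  cone_measure (rotT (Psi a b c) @^-1` B) = cone_measure B.
Proof.
pose rot c0 s0 v : R * R * R :=
  ((c0 * v.1.1 - s0 * v.1.2, s0 * v.1.1 + c0 * v.1.2), v.2).
pose swap v : R * R * R := ((v.1.1, v.2), v.1.2).
have mrot c0 s0 : measurable_fun setT (rot c0 s0).
  apply: measurable_fun_pair => //=.
  apply: (@measurableT_comp _ _ _ _ _ _ (fun p : R * R =>
    (c0 * p.1 - s0 * p.2, s0 * p.1 + c0 * p.2))); last exact: measurable_fst.
  have := measurable_fun_linear2 c0 (- s0) s0 c0.
  by apply: eq_measurable_fun => p _; rewrite mulNr.
have mswap : measurable_fun setT swap.
  apply: measurable_fun_pair => /=.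
    apply: measurable_fun_pair => //.
    exact: (measurableT_comp measurable_fst measurable_fst).
  exact: (measurableT_comp measurable_snd measurable_fst).
have inv3 t E : measurable E ->
    cone_measure (rotT (Psi t 0 0) @^-1` E) = cone_measure E.
  have cs : cos t ^+ 2 + (- sin t) ^+ 2 = 1 by rewrite sqrrN cos2Dsin2.
  apply: (@cone_measure_invariant _ (rot (cos t) (- sin t))).
  - exact: mrot.
  - by move=> f mf f0; exact: ge0_integral_rotation12.
  - move=> v; rewrite /sqnorm3 /rot /=.
    transitivity ((cos t ^+ 2 + (- sin t) ^+ 2) * (v.1.1 ^+ 2 + v.1.2 ^+ 2) + v.2 ^+ 2).
      by ring.
    by rewrite cs mul1r.
  - move=> v; rewrite /= /Psi_mx R2_0 R3_0 !mulmx1.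
    apply/matrixP => -[[|[|[|//]]] hi] j;
    by rewrite !mxE !big_ord_recl big_ord0 !mxE/=; ring.
have inv2 t E : measurable E ->
    cone_measure (rotT (Psi 0 t 0) @^-1` E) = cone_measure E.
  have cs : cos t ^+ 2 + sin t ^+ 2 = 1 by rewrite cos2Dsin2.
  apply: (@cone_measure_invariant _ (swap \o rot (cos t) (sin t) \o swap)).
  - by apply: measurableT_comp => //; apply: measurableT_comp.
  - move=> f mf f0.
    pose f1 v := f (swap v); pose f2 v := f1 (rot (cos t) (sin t) v).
    have mf1 : measurable_fun setT f1 by exact: measurableT_comp.
    have mf2 : measurable_fun setT f2 by apply: measurableT_comp => //; exact: mrot.
    have f10 v : (0 <= f1 v)%E by exact: f0.
    have f20 v : (0 <= f2 v)%E by exact: f0.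
    transitivity (\int[lam3]_v f2 v)%E.
      by rewrite -(ge0_integral_swap23 mf2 f20); apply: eq_integral.
    transitivity (\int[lam3]_v f1 v)%E.
      by rewrite -(ge0_integral_rotation12 cs mf1 f10); apply: eq_integral.
    by rewrite -(ge0_integral_swap23 mf f0); apply: eq_integral.
  - move=> v; rewrite /sqnorm3 /rot /=.
    transitivity ((cos t ^+ 2 + sin t ^+ 2) * (v.1.1 ^+ 2 + v.2 ^+ 2) + v.1.2 ^+ 2).
      by ring.
    by rewrite cs mul1r; ring.
  - move=> v; rewrite /= /Psi_mx R3_0 mulmx1 mul1mx.
    apply/matrixP => -[[|[|[|//]]] hi] j;
    by rewrite !mxE !big_ord_recl big_ord0 !mxE/=; ring.
have mrotT A E : measurable E -> measurable (@rotT R A @^-1` E).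
  by move=> mE; rewrite -[X in measurable X]setTI; exact: measurable_rotT.
move=> mB; have -> : rotT (Psi a b c) @^-1` B =
    rotT (Psi a 0 0) @^-1` (rotT (Psi 0 b 0) @^-1` (rotT (Psi c 0 0) @^-1` B)).
  by apply/funext => x /=; rewrite rotT_Psi.
have mB1 : measurable (rotT (Psi c 0 0) @^-1` B) by exact: mrotT.
have mB2 := mrotT (Psi 0 b 0) _ mB1.
by rewrite (inv3 a _ mB2) (inv2 b _ mB1) (inv3 c _ mB).
Qed.

End cone_measure.

(** * Averages over roots of unity and zonal polynomials *)

Section root_of_unity_average.
Variable F : fieldType.
Implicit Types (w al be ga : F).

Definition central_bin k : nat := if odd k then 0%N else 'C(k, k./2).

(** Only even powers of the variable occur, so the middle coefficient vanishes for
odd [k]. *)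
Lemma coef_central k al be :
  ((al *: 'X^2 + be%:P) ^+ k)`_k = (central_bin k)%:R * (al * be) ^+ k./2 :> F.
Proof.
rewrite exprDn coef_sum.
have cE (i : 'I_k.+1) : (((al *: 'X^2) ^+ (k - i) * be%:P ^+ i) *+ 'C(k, i))`_k =
    (if ((k - i).*2 == k)%N then al ^+ (k - i) * be ^+ i *+ 'C(k, i) else 0).
  rewrite coefMn -rmorphXn/= coefMC exprZn coefZ -exprM coefXn mul2n.
  by rewrite eq_sym; case: eqP => _; rewrite ?mulr1// mulr0 mul0r mul0rn.
under eq_bigr do rewrite cE.
rewrite /central_bin; case: ifPn => [ok|/negbTE ek].
  rewrite mul0r big1// => i _; case: eqP => // e.
  by rewrite -e odd_double in ok.
have kE : (k./2.*2 = k)%N by rewrite -[RHS]odd_double_half ek.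
have lt : (k./2 < k.+1)%N by rewrite ltnS -{2}kE -addnn leq_addr.
have kk : (k - k./2 = k./2)%N by rewrite -{1}kE -addnn addnK.
rewrite (bigD1 (Ordinal lt))//= kk kE eqxx big1 ?addr0.
  by rewrite exprMn mulr_natl.
move=> i /eqP ni; case: eqP => // e; case: ni; apply: val_inj => /=.
have ik := ltn_ord i; rewrite ltnS in ik.
by move: e kE ik; rewrite -!addnn; move: (k./2); lia.
Qed.

(** The bound on [i] ensures that [i - n] is a multiple of [n + 1] only if it is
zero. *)
Lemma sum_root_power w n i : n.+1.-primitive_root w -> (i <= n.*2)%N ->
  \sum_(j < n.+1) (w ^+ j) ^+ i * (w ^+ j) ^- n = (i == n)%:R * n.+1%:R.
Proof.
move=> pw i2n; have w0 : w != 0.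
  apply/eqP => w0; have := prim_expr_order pw.
  by rewrite w0 expr0n => /esym/eqP; rewrite oner_eq0.
pose z := w ^+ i / w ^+ n.
have -> : \sum_(j < n.+1) (w ^+ j) ^+ i * (w ^+ j) ^- n = \sum_(j < n.+1) z ^+ j.
  by apply: eq_bigr => j _; rewrite /z expr_div_n -!exprM !(mulnC j).
have [iE|ni] := eqVneq i n.
  rewrite /z iE divff ?expf_neq0// (eq_bigr (fun=> 1)); last by move=> j _; rewrite expr1n.
  by rewrite sumr_const card_ord mul1r.
rewrite mul0r; apply: (mulfI (x := z - 1)).
  rewrite subr_eq0; apply: contra ni => /eqP z1.
  have : w ^+ i == w ^+ n by rewrite -[w ^+ n]mul1r -z1 divfK// expf_neq0.
  rewrite (eq_prim_root_expr pw) => /eqP; rewrite (modn_small (leqnn n.+1)).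
  move: i2n; rewrite -addnn => i2n e; apply/eqP.
  have := divn_eq i n.+1; rewrite e; case: (_ %/ _)%N => [|q]; lia.
rewrite -subrX1 mulr0 /z expr_div_n -!exprM !(mulnC _ n.+1) !exprM.
by rewrite (prim_expr_order pw) !expr1n divr1 subrr.
Qed.

(** Dividing the [n]-th power of the trinomial [be + al X + ga X^2] by [X^n] and
summing over the roots of unity keeps the coefficient of [X^n] only. *)
Lemma sum_root_trinomial w n al be ga : n.+1.-primitive_root w ->
  \sum_(j < n.+1) (al + be * (w ^+ j)^-1 + ga * w ^+ j) ^+ n =
  n.+1%:R * \sum_(k < n.+1) al ^+ (n - k) *
     (central_bin k)%:R * (ga * be) ^+ k./2 *+ 'C(n, k).
Proof.
move=> pw; have w0 : w != 0.
  apply/eqP => w0; have := prim_expr_order pw.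
  by rewrite w0 expr0n => /esym/eqP; rewrite oner_eq0.
pose p : {poly F} := (al *: 'X + (ga *: 'X^2 + be%:P)) ^+ n.
have sp : (size p <= n.*2.+1)%N.
  apply: (leq_trans (size_poly_exp_leq _ _)).
  rewrite ltnS -muln2 mulnC leq_mul// -subn1 leq_subLR add1n.
  apply: (leq_trans (size_polyD _ _)); rewrite geq_max.
  rewrite (leq_trans (size_scale_leq _ _)) ?size_polyX//=.
  apply: (leq_trans (size_polyD _ _)); rewrite geq_max.
  by rewrite (leq_trans (size_scale_leq _ _)) ?size_polyXn//= (leq_trans (size_polyC_leq1 _)).
transitivity (\sum_(j < n.+1) \sum_(i < n.*2.+1) p`_i * ((w ^+ j) ^+ i * (w ^+ j) ^- n)).
  apply: eq_bigr => j _; have wj0 : w ^+ j != 0 by rewrite expf_neq0.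
  transitivity (p.[w ^+ j] * (w ^+ j) ^- n).
    rewrite /p horner_exp -expr_div_n; congr (_ ^+ n); rewrite !hornerE/=.
    by move: (w ^+ j) wj0 => u u0; field.
  by rewrite (horner_coef_wide _ sp) mulr_suml; apply: eq_bigr => i _; rewrite mulrA.
rewrite exchange_big /=.
transitivity (\sum_(i < n.*2.+1) p`_i * ((i == n :> nat)%:R * n.+1%:R)).
  apply: eq_bigr => i _; rewrite -mulr_sumr sum_root_power//.
  by have := ltn_ord i; rewrite ltnS.
have n2 : (n < n.*2.+1)%N by rewrite ltnS -addnn leq_addr.
rewrite (bigD1 (Ordinal n2))//= eqxx mul1r big1 ?addr0; last first.
  move=> i; rewrite -val_eqE /= => /negbTE ->; by rewrite mul0r mulr0.
rewrite mulrC; congr (_ * _); rewrite /p exprDn coef_sum.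
apply: eq_bigr => k _; rewrite coefMn exprZn -scalerAl coefZ coefXnM.
have kn : (k <= n)%N by have := ltn_ord k; rewrite ltnS.
rewrite ltnNge leq_subr /= subKn// coef_central mulrA; congr (_ *+ _).
Qed.

End root_of_unity_average.

Section zonal_polynomial.
Context {R : realType}.
Implicit Types a b r t : R.

(** [re_pow a (a ^ 2 + b ^ 2) n] is the real part of [(a + i b) ^ n], see [re_powE].
The squared modulus is the natural second argument: it is known without [b]. *)
Fixpoint re_pow a r n : R :=
  if n is n1.+1 then
    if n1 is n2.+1 then 2 * a * re_pow a r n1 - r * re_pow a r n2 else a
  else 1.

Lemma re_powE a b n :
  complex.Re ((a +i* b)%C ^+ n) = re_pow a (a ^+ 2 + b ^+ 2) n.
Proof.
suff : complex.Re ((a +i* b)%C ^+ n) = re_pow a (a ^+ 2 + b ^+ 2) n /\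
  complex.Re ((a +i* b)%C ^+ n.+1) = re_pow a (a ^+ 2 + b ^+ 2) n.+1 by case.
elim: n => [|n [IH1 IH2]]; first by rewrite expr1.
split => //; rewrite [RHS]/= -/(re_pow a _ n.+1) -IH1 -IH2 !exprS.
by case: (_ ^+ n) => u v /=; ring.
Qed.

Lemma re_pow_bound a r n : `|a| <= 1 -> `|r| <= 1 -> `|re_pow a r n| <= 3 ^+ n.
Proof.
move=> a1 r1; suff : `|re_pow a r n| <= 3 ^+ n /\ `|re_pow a r n.+1| <= 3 ^+ n.+1.
  by case.
elim: n => [|n [IH1 IH2]]; first by rewrite /= normr1 expr0 expr1; split=> //; lra.
split => //; rewrite [re_pow _ _ _]/= -/(re_pow a _ n.+1).
apply: (le_trans (ler_normB _ _)); rewrite !normrM ger0_norm//.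
have e0 : 0 <= 3 ^+ n :> R by rewrite exprn_ge0.
have h1 : `|a| * `|re_pow a r n.+1| <= 1 * 3 ^+ n.+1 by rewrite ler_pM.
have h2 : `|r| * `|re_pow a r n| <= 1 * 3 ^+ n by rewrite ler_pM.
by move: h1 h2; rewrite !exprS; lra.
Qed.

(** Laplace's expansion of the Legendre polynomial of degree [n]. *)
Definition zonal n : {poly R} := \sum_(k < n.+1)
  ((central_bin k)%:R / 4 ^+ k./2 *+ 'C(n, k)) *: ('X^(n - k) * ('X^2 - 1) ^+ k./2).

Lemma horner_zonal n t : (zonal n).[t] = \sum_(k < n.+1)
  t ^+ (n - k) * (central_bin k)%:R * ((t ^+ 2 - 1) / 4) ^+ k./2 *+ 'C(n, k).
Proof.
rewrite horner_sum; apply: eq_bigr => k _.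
rewrite !hornerE/= expr_div_n -(mulr_natr (_ / _)) -[RHS]mulr_natr.
by ring.
Qed.

Lemma zonal_term n k : (k <= n)%N -> ~~ odd k ->
  let q : {poly R} := 'X^(n - k) * ('X^2 - 1) ^+ k./2 in
  size q = n.+1 /\ q`_n = 1.
Proof.
move=> kn ek q; have kE : (k./2.*2 = k)%N by rewrite -[RHS]odd_double_half (negbTE ek).
have m2 : ('X^2 - 1 : {poly R}) \is monic by rewrite monicXnsubC.
have mq : q \is monic by rewrite monicMl ?monicXn// monic_exp.
have sq : size q = n.+1.
  have m2k : ('X^2 - 1 : {poly R}) ^+ k./2 \is monic by rewrite monic_exp.
  have s1 : size (('X^2 - 1 : {poly R}) ^+ k./2) = k.+1.
    have := size_exp ('X^2 - 1 : {poly R}) k./2.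
    rewrite size_XnsubC//= mul2n kE => e.
    by rewrite -[in RHS]e prednK// size_poly_gt0 monic_neq0.
  rewrite size_Mmonic ?monic_neq0 ?monicXn// size_polyXn s1.
  by rewrite addnS /= addSn subnK.
by split => //; rewrite -(monicP mq) lead_coefE sq.
Qed.

Lemma zonal_lead n : (size (zonal n) <= n.+1)%N /\ 0 < (zonal n)`_n.
Proof.
have c0 k : odd k -> central_bin k = 0%N by rewrite /central_bin => ->.
split.
  apply: (leq_trans (size_sum _ _ _)); apply/bigmax_leqP => k _.
  have kn : (k <= n)%N by rewrite -ltnS.
  have [ok|ek] := boolP (odd k).
    by rewrite c0// mul0r mul0rn scale0r size_poly0.
  apply: (leq_trans (size_scale_leq _ _)).
  by have [-> _] := zonal_term kn ek.
have term (k : 'I_n.+1) : 0 <= (((central_bin k)%:R / 4 ^+ k./2 *+ 'C(n, k)) *: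
    ('X^(n - k) * ('X^2 - 1) ^+ k./2 : {poly R}))`_n.
  have kn : (k <= n)%N by rewrite -ltnS.
  have [ok|ek] := boolP (odd k); first by rewrite c0// mul0r mul0rn scale0r coef0.
  have [_ q1] := zonal_term kn ek; rewrite coefZ q1 mulr1.
  by rewrite mulrn_wge0// mulr_ge0// invr_ge0 exprn_ge0.
rewrite coef_sum big_ord_recl ltr_pwDl//; last by apply: sumr_ge0 => k _; exact: term.
have [_ q1] := @zonal_term n 0 (leq0n n) isT.
by rewrite coefZ q1 /central_bin/= !bin0 expr0 divr1 mulr1.
Qed.

Let omega n : R[i] := (cos (pi *+ 2 / n.+1%:R) +i* sin (pi *+ 2 / n.+1%:R))%C.

Lemma omegaX n j : omega n ^+ j =
  (cos (pi *+ 2 / n.+1%:R *+ j) +i* sin (pi *+ 2 / n.+1%:R *+ j))%C.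
Proof.
rewrite /omega; move: (pi *+ 2 / _) => t.
elim: j => [|j IH]; first by rewrite mulr0n cos0 sin0.
rewrite exprS IH mulrS cosD sinD; apply/eqP; rewrite eq_complex /=.
by rewrite eqxx/= addrC.
Qed.

Lemma omega_prim n : n.+1.-primitive_root (omega n).
Proof.
apply/andP; split => //; apply/forallP => i; apply/eqP.
rewrite unity_rootE omegaX.
have n0 : n.+1%:R != 0 :> R by rewrite pnatr_eq0.
have [e|ne] := eqVneq i.+1 n.+1.
  rewrite e; apply/eqP.
  have -> : pi *+ 2 / n.+1%:R *+ n.+1 = pi *+ 2 :> R.
    by rewrite -mulr_natr divfK.
  by rewrite cos2pi sin2pi.
apply/negbTE; apply/eqP => -[c1 _]; set t := (_ *+ i.+1) in c1.
have tE : t = (t / 2) *+ 2 by rewrite -mulr_natr divfK.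
have t0 : 0 < t / 2 < pi.
  have pi0 := @pi_gt0 R.
  have -> : t / 2 = pi * (i.+1%:R / n.+1%:R) by rewrite /t -(mulr_natr _ i.+1) -(mulr_natr pi 2); field.
  rewrite mulr_gt0//= ?divr_gt0// gtr_pMr// ltr_pdivrMr// mul1r ltr_nat.
  by rewrite ltn_neqAle ltn_ord andbT; apply: contra ne => /eqP ->.
have s0 := sin_gt0_pi t0; have cs := cos2Dsin2 (t / 2).
by rewrite tE cos_mulr2n in c1; nra.
Qed.

Let rmorph_monomial (A B : nzRingType) (f : {rmorphism A -> B}) (x y : A)
    (a b c m : nat) :
  f (x ^+ a * m%:R * y ^+ b *+ c) = f x ^+ a * m%:R * f y ^+ b *+ c.
Proof. by rewrite rmorphMn !rmorphM !rmorphXn rmorph_nat. Qed.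

(** Here [e] is a unit vector, [S] is up to sign the sine of its angle with the axis,
and [d] is its scalar product with the rotated vector [y].  Each summand is the real part
of the [n]-th power of [al + be / w + ga * w], where [w] runs through the roots
of unity.  The product [ga * be = S ^ 2 (y3 ^ 2 - 1) / 4] is real and does not
depend on the azimuths of [e] and [y]; its sign is what makes all terms of
[zonal n] add up without cancellation in degree [n]. *)
Lemma re_pow_average n (e1 e2 e3 S y1 y2 y3 : R) :
  S != 0 -> e1 ^+ 2 + e2 ^+ 2 = S ^+ 2 -> S ^+ 2 + e3 ^+ 2 = 1 ->
  y1 ^+ 2 + y2 ^+ 2 + y3 ^+ 2 = 1 ->
  \sum_(j < n.+1)
    (let t := pi *+ 2 / n.+1%:R *+ j in
     let d := e1 * (cos t * y1 + sin t * y2) +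
              e2 * (- sin t * y1 + cos t * y2) + e3 * y3 in
     re_pow ((y3 - e3 * d) / S) (1 - d ^+ 2) n) =
  n.+1%:R * (S ^+ n * (zonal n).[y3]).
Proof.
move=> S0 eS e3S yS.
pose P := e1 * y1 + e2 * y2; pose Q := e1 * y2 - e2 * y1.
have PQ : P ^+ 2 + Q ^+ 2 = S ^+ 2 * (1 - y3 ^+ 2).
  transitivity ((e1 ^+ 2 + e2 ^+ 2) * (y1 ^+ 2 + y2 ^+ 2)); first by rewrite /P /Q; ring.
  by rewrite eS -yS; ring.
(* P + i Q is the product of the conjugate of e1 + i e2 with y1 + i y2. *)
pose al := ((S * y3)%:C)%C.
pose be := (((1 - e3) / (2 * S) * P) +i* ((1 - e3) / (2 * S) * Q))%C.
pose ga := ((- (1 + e3) / (2 * S) * P) +i* ((1 + e3) / (2 * S) * Q))%C.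
pose w := omega n.
transitivity (complex.Re (\sum_(j < n.+1) (al + be * (w ^+ j)^-1 + ga * w ^+ j) ^+ n)).
  rewrite raddf_sum; apply: eq_bigr => j _ /=.
  rewrite /w omegaX; set t := _ *+ j; set c := cos t; set s := sin t.
  have cs : c ^+ 2 + s ^+ 2 = 1 by exact: cos2Dsin2.
  have -> : ((c +i* s)%C)^-1 = (c -i* s)%C.
    by apply/eqP; rewrite eq_complex /= cs !divr1 !eqxx.
  set a := (y3 - e3 * _) / S.
  pose b := (P * - s + Q * c) / S.
  set d := (X in 1 - X ^+ 2) in a *.
  have dE : d = P * c + Q * s + e3 * y3 by rewrite /d /P /Q; ring.
  have -> : 1 - d ^+ 2 = a ^+ 2 + b ^+ 2.
    have K : (P * - s + Q * c) ^+ 2 = S ^+ 2 * (1 - y3 ^+ 2) - (d - e3 * y3) ^+ 2.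
      rewrite dE -PQ addrK.
      transitivity ((c ^+ 2 + s ^+ 2) * (P ^+ 2 + Q ^+ 2) - (P * c + Q * s) ^+ 2).
        by ring.
      by rewrite cs mul1r.
    have N : (y3 - e3 * d) ^+ 2 + (P * - s + Q * c) ^+ 2 = S ^+ 2 * (1 - d ^+ 2).
      rewrite K; apply/eqP; rewrite -subr_eq0; apply/eqP.
      transitivity ((1 - (S ^+ 2 + e3 ^+ 2)) * (y3 ^+ 2 - d ^+ 2)); first by ring.
      by rewrite e3S subrr mul0r.
    rewrite /a /b !expr_div_n -mulrDl N mulrAC divff ?mul1r//.
    by rewrite expf_neq0.
  rewrite -re_powE; congr (complex.Re (_ ^+ n)).
  apply/eqP; rewrite eq_complex /=; apply/andP; split; apply/eqP.
    have -> : S * y3 = (1 - e3 ^+ 2) * y3 / S by rewrite -e3S; field.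
    by rewrite /a -/d dE; field.
  by rewrite /b; field.
rewrite sum_root_trinomial; last exact: omega_prim.
have gb : ga * be = ((S ^+ 2 * ((y3 ^+ 2 - 1) / 4))%:C)%C.
  apply/eqP; rewrite eq_complex /=; apply/andP; split; apply/eqP; last by field.
  transitivity ((e3 ^+ 2 - 1) * (P ^+ 2 + Q ^+ 2) / (4 * S ^+ 2)); first by field.
  have -> : e3 ^+ 2 - 1 = - S ^+ 2 by rewrite -e3S; ring.
  by rewrite PQ; field.
have -> : \sum_(k < n.+1) al ^+ (n - k) * (central_bin k)%:R *
    (ga * be) ^+ k./2 *+ 'C(n, k) = ((S ^+ n * (zonal n).[y3])%:C)%C.
  rewrite horner_zonal mulr_sumr rmorph_sum; apply: eq_bigr => k _.
  rewrite gb; transitivity (((S * y3) ^+ (n - k) * (central_bin k)%:R *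
      (S ^+ 2 * ((y3 ^+ 2 - 1) / 4)) ^+ k./2 *+ 'C(n, k))%:C)%C.
    by rewrite -[RHS]/(real_complex R _) rmorph_monomial.
  congr (_%:C)%C; rewrite [RHS]mulrnAr; congr (_ *+ _); rewrite !exprMn.
  have [ok|ek] := boolP (odd k).
    by rewrite /central_bin ok !(mulr0, mul0r).
  have kn : (k <= n)%N by rewrite -ltnS.
  have kE : (k./2.*2 = k)%N by rewrite -[RHS]odd_double_half (negbTE ek).
  have -> : S ^+ n = S ^+ (n - k) * (S ^+ 2) ^+ k./2.
    by rewrite -exprM mul2n kE -exprD subnK.
  rewrite [S ^+ 2]expr2 !exprMn.
  set s1 := S ^+ (n - k); set s2 := S ^+ k./2; set s3 := y3 ^+ (n - k).
  by set s4 := (_ - 1) ^+ k./2; set s5 := 4^-1 ^+ k./2; ring.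
by rewrite -(rmorph_nat (real_complex R)) -rmorphM.
Qed.

End zonal_polynomial.

(** * Bounded measurable functions and the zonal kernel *)

Section bounded_measurable.
Context d (T : measurableType d) (R : realType).
Implicit Types (f g : T -> R) (m : {finite_measure set T -> \bar R}).

Definition bounded_mfun f := measurable_fun setT f /\ exists M, forall x, `|f x| <= M.

Lemma bounded_mfun_cst c : bounded_mfun (fun=> c).
Proof. by split; [exact: measurable_cst|exists `|c|]. Qed.

Lemma bounded_mfunD f g : bounded_mfun f -> bounded_mfun g ->
  bounded_mfun (fun x => f x + g x).
Proof.
move=> [mf [M fM]] [mg [N gN]]; split; first exact: measurable_funD.
by exists (M + N) => x; apply: (le_trans (ler_normD _ _)); exact: lerD.
Qed.

Lemma bounded_mfunM f g : bounded_mfun f -> bounded_mfun g ->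
  bounded_mfun (fun x => f x * g x).
Proof.
move=> [mf [M fM]] [mg [N gN]]; split; first exact: measurable_funM.
by exists (M * N) => x; rewrite normrM; exact: ler_pM.
Qed.

Lemma bounded_mfunB f g : bounded_mfun f -> bounded_mfun g ->
  bounded_mfun (fun x => f x - g x).
Proof.
move=> [mf [M fM]] [mg [N gN]]; split; first exact: measurable_funB.
by exists (M + N) => x; apply: (le_trans (ler_normB _ _)); exact: lerD.
Qed.

Lemma bounded_mfunX f n : bounded_mfun f -> bounded_mfun (fun x => f x ^+ n).
Proof.
move=> [mf [M fM]]; split; first exact: measurable_funX.
exists (M ^+ n) => x; rewrite normrX lerXn2r// nnegrE//.
exact: le_trans (fM x).
Qed.

Lemma bounded_mfun_sum I (r : seq I) (F : I -> T -> R) :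
  (forall i, bounded_mfun (F i)) -> bounded_mfun (fun x => \sum_(i <- r) F i x).
Proof.
move=> bF; elim: r => [|i r IH].
  by under eq_fun do rewrite big_nil; exact: bounded_mfun_cst.
by under eq_fun do rewrite big_cons; exact: bounded_mfunD.
Qed.

Lemma bounded_mfun_indic A : measurable A -> bounded_mfun (\1_A : T -> R).
Proof.
move=> mA; split; first exact: measurable_indic.
by exists 1 => x; rewrite indicE; case: (_ \in _); rewrite ?normr1 ?normr0.
Qed.

Lemma bounded_mfun_integrable m f : bounded_mfun f ->
  m.-integrable setT (EFin \o f).
Proof.
move=> [mf [M fM]]; apply: measurable_bounded_integrable => //.
  by rewrite -ge0_fin_numE// fin_num_measure.
exists M; split; first exact: num_real.
by move=> N MN x _; apply: (le_trans (fM x)); exact: ltW.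
Qed.

Lemma EFin_Rintegral m f : bounded_mfun f ->
  (\int[m]_x f x)%:E = (\int[m]_x (f x)%:E)%E.
Proof.
move=> bf; rewrite /Rintegral fineK//.
by apply: integrable_fin_num => //; exact: bounded_mfun_integrable.
Qed.

Lemma Rintegral_ae m f g N : measurable N -> m N = 0%E ->
  bounded_mfun f -> bounded_mfun g -> (forall x, ~ N x -> f x = g x) ->
  \int[m]_x f x = \int[m]_x g x.
Proof.
move=> mN N0 [mf _] [mg _] fg; congr fine; apply: ae_eq_integral => //.
- exact/measurable_EFinP.
- exact/measurable_EFinP.
- exists N; split=> // x /= h; apply: contrapT => nN; apply: h => _.
  by rewrite fg.
Qed.

Lemma EFin_Rintegral_indic m A : measurable A -> (\int[m]_x \1_A x)%:E = m A.
Proof.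
move=> mA; rewrite EFin_Rintegral; last exact: bounded_mfun_indic.
by rewrite integral_indic// setIT.
Qed.

(** For a nonnegative function the null set can be taken measurable. *)
Lemma Rintegral_eq0 m f : bounded_mfun f -> (forall x, 0 <= f x) ->
  \int[m]_x f x = 0 ->
  exists N, [/\ measurable N, m N = 0%E & forall x, ~ N x -> f x = 0].
Proof.
move=> bf f0 If; have mf : measurable_fun setT (EFin \o f).
  by apply/measurable_EFinP; case: bf.
have [h _] := ae_eq_integral_abs m measurableT mf.
have /h[N [mN N0 sN]] : (\int[m]_x `|(EFin \o f) x| = 0)%E.
  transitivity (\int[m]_x f x)%:E; last by rewrite If.
  rewrite EFin_Rintegral//; apply: eq_integral => x _.
  by rewrite /= ger0_norm.
exists N; split => // x nN; apply/EFin_inj; apply: contrapT => fx.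
by apply: nN; apply: sN => /= /(_ Logic.I).
Qed.

Lemma Rintegral_sum m I (r : seq I) (F : I -> T -> R) :
  (forall i, bounded_mfun (F i)) ->
  \int[m]_x (\sum_(i <- r) F i x) = \sum_(i <- r) \int[m]_x F i x.
Proof.
move=> bF; elim: r => [|i r IH].
  rewrite big_nil; under eq_Rintegral do rewrite big_nil.
  by rewrite Rintegral_cst// mul0r.
rewrite big_cons; under eq_Rintegral do rewrite big_cons.
rewrite RintegralD ?IH//; apply: bounded_mfun_integrable => //.
exact: bounded_mfun_sum.
Qed.

Lemma Rintegral_invariant m (h : T -> T) f : measurable_fun setT h ->
  (forall A, measurable A -> m (h @^-1` A) = m A) ->
  bounded_mfun f -> \int[m]_x f (h x) = \int[m]_x f x.
Proof.
move=> mh mi bf; congr fine; have [mf [M fM]] := bf.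
have ei : m.-integrable (h @^-1` setT) ((EFin \o f) \o h).
  rewrite preimage_setT; apply: (@bounded_mfun_integrable m (f \o h)); split.
    exact: measurableT_comp.
  by exists M => x; exact: fM.
have mEf : measurable_fun setT (EFin \o f) by exact/measurable_EFinP.
have := @integral_pushforward _ _ _ _ _ h mh m setT (EFin \o f) mEf ei measurableT.
rewrite preimage_setT /= => <-.
by apply: eq_measure_integral => A mA _; exact: mi.
Qed.

End bounded_measurable.

Section bounded_fubini.
Context d1 d2 (T1 : measurableType d1) (T2 : measurableType d2) (R : realType).
Variables (m1 : {finite_measure set T1 -> \bar R})
  (m2 : {finite_measure set T2 -> \bar R}).
Variable f : T1 * T2 -> R.
Hypothesis bf : bounded_mfun f.

Lemma bounded_mfun_pair1 x : bounded_mfun (fun y => f (x, y)).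
Proof.
have [mf [M fM]] := bf; split; last by exists M.
exact: measurableT_comp.
Qed.

Lemma bounded_mfun_pair2 y : bounded_mfun (fun x => f (x, y)).
Proof.
have [mf [M fM]] := bf; split; last by exists M.
exact: measurableT_comp.
Qed.

Lemma integrable_pair : (m1 \x m2)%E.-integrable setT (EFin \o f).
Proof.
have fin : ((m1 \x m2) setT < +oo)%E.
  rewrite -setXTT product_measure1E//.
  by rewrite lte_mul_pinfty// ?fin_num_measure// -ge0_fin_numE// fin_num_measure.
have [mf [M fM]] := bf; apply: measurable_bounded_integrable => //.
exists M; split; first exact: num_real.
by move=> N MN x _; apply: (le_trans (fM x)); exact: ltW.
Qed.

Lemma bounded_mfun_Rintegral1 : bounded_mfun (fun x => \int[m2]_y f (x, y)).
Proof.
have [mf [M fM]] := bf; split.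
  apply/measurable_EFinP.
  have := @measurable_fubini_F _ _ _ _ _ m1 m2 (EFin \o f) integrable_pair.
  apply: eq_measurable_fun => x _; rewrite /fubini_F /= EFin_Rintegral//.
  exact: bounded_mfun_pair1.
exists (M * fine (m2 setT)) => x.
have bx := bounded_mfun_pair1 x.
apply: (le_trans (le_normr_Rintegral _ _)) => //; first exact: bounded_mfun_integrable.
rewrite -Rintegral_cst//; apply: le_Rintegral => //.
- by apply: integrable_norm; exact: bounded_mfun_integrable.
- by apply: bounded_mfun_integrable; exact: bounded_mfun_cst.
Qed.

Lemma bounded_mfun_Rintegral2 : bounded_mfun (fun y => \int[m1]_x f (x, y)).
Proof.
have [mf [M fM]] := bf; split.
  apply/measurable_EFinP.
  have := @measurable_fubini_G _ _ _ _ _ m1 m2 (EFin \o f) integrable_pair.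
  apply: eq_measurable_fun => y _; rewrite /fubini_G /= EFin_Rintegral//.
  exact: bounded_mfun_pair2.
exists (M * fine (m1 setT)) => y.
have bx := bounded_mfun_pair2 y.
apply: (le_trans (le_normr_Rintegral _ _)) => //; first exact: bounded_mfun_integrable.
rewrite -Rintegral_cst//; apply: le_Rintegral => //.
- by apply: integrable_norm; exact: bounded_mfun_integrable.
- by apply: bounded_mfun_integrable; exact: bounded_mfun_cst.
Qed.

Lemma EFin_Rintegral_iter : (\int[m1]_x \int[m2]_y f (x, y))%:E =
  (\int[m1]_x \int[m2]_y (f (x, y))%:E)%E.
Proof.
rewrite EFin_Rintegral; last exact: bounded_mfun_Rintegral1.
by apply: eq_integral => x _; rewrite EFin_Rintegral//; exact: bounded_mfun_pair1.
Qed.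

Lemma Rintegral_fubini : \int[m1]_x \int[m2]_y f (x, y) =
  \int[m2]_y \int[m1]_x f (x, y).
Proof.
apply: EFin_inj; rewrite EFin_Rintegral_iter.
rewrite EFin_Rintegral; last exact: bounded_mfun_Rintegral2.
rewrite (@Fubini _ _ _ _ _ m1 m2 (EFin \o f) integrable_pair).
by apply: eq_integral => y _; rewrite EFin_Rintegral//; exact: bounded_mfun_pair2.
Qed.

Lemma Rintegral_product : (\int[m1]_x \int[m2]_y f (x, y))%:E =
  (\int[m1 \x m2]_z (f z)%:E)%E.
Proof. by rewrite EFin_Rintegral_iter -(integral12_prod_meas1 integrable_pair). Qed.

End bounded_fubini.

Section zonal_kernel.
Context {R : realType}.
Implicit Types (x y xi eta : S2 R) (n : nat).
Local Notation cone := (@cone_measure R).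

(** The real part of [<Q e1 + i Q e2, y> ^ n] for the frame [Q] with [Q e3 = eta] and
[xi] in the half plane spanned by [Q e3] and [Q e1], expressed by scalar products;
see [frame_kernel_T_W].  If [xi] is [eta] or [- eta], the quotient is
[0] by the convention for the inverse of [0]. *)
Definition zkernel n y eta xi : R :=
  re_pow ((dot xi y - dot xi eta * dot eta y) / Num.sqrt (1 - dot xi eta ^+ 2))
         (1 - dot eta y ^+ 2) n.

Lemma zkernel_rotT n A y eta xi :
  zkernel n (rotT A y) (rotT A eta) (rotT A xi) = zkernel n y eta xi.
Proof. by rewrite /zkernel !dot_rotT. Qed.

Lemma measurable_meridian : measurable [set x : S2 R | val x 1 0 = 0].
Proof.
have := @measurable_S2_coord R 1 measurableT [set 0] (measurable_set1 0).
by rewrite setTI.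
Qed.

Lemma dot_norm_le1 x y : `|dot x y| <= 1.
Proof.
have := S2E x; have := S2E y; rewrite dotE.
set a := val x 0 0; set b := val x 1 0; set c := val x 2%:R 0.
set a' := val y 0 0; set b' := val y 1 0; set c' := val y 2%:R 0 => h h'.
rewrite ler_norml; apply/andP; split.
  suff : 0 <= (a + a') ^+ 2 + (b + b') ^+ 2 + (c + c') ^+ 2 by nra.
  by rewrite !addr_ge0// sqr_ge0.
suff : 0 <= (a - a') ^+ 2 + (b - b') ^+ 2 + (c - c') ^+ 2 by nra.
by rewrite !addr_ge0// sqr_ge0.
Qed.

Lemma dot_sqr_le1 x y : dot x y ^+ 2 <= 1.
Proof. by have := dot_norm_le1 x y; rewrite ler_norml => /andP[]; nra. Qed.

Let cauchy_schwarz3 (u1 u2 u3 v1 v2 v3 : R) :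
  (u1 * v1 + u2 * v2 + u3 * v3) ^+ 2 <=
  (u1 ^+ 2 + u2 ^+ 2 + u3 ^+ 2) * (v1 ^+ 2 + v2 ^+ 2 + v3 ^+ 2).
Proof.
rewrite -subr_ge0.
have -> : (u1 ^+ 2 + u2 ^+ 2 + u3 ^+ 2) * (v1 ^+ 2 + v2 ^+ 2 + v3 ^+ 2) -
    (u1 * v1 + u2 * v2 + u3 * v3) ^+ 2 =
    (u1 * v2 - u2 * v1) ^+ 2 + (u1 * v3 - u3 * v1) ^+ 2 +
    (u2 * v3 - u3 * v2) ^+ 2 by ring.
by rewrite !addr_ge0// sqr_ge0.
Qed.

(** Cauchy-Schwarz for the components of [xi] and [y] orthogonal to [eta]. *)
Lemma dot_gram xi eta y : (dot xi y - dot xi eta * dot eta y) ^+ 2 <=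
  (1 - dot xi eta ^+ 2) * (1 - dot eta y ^+ 2).
Proof.
have hx := dotxx xi; have hy := dotxx y; have he := dotxx eta.
move: hx hy he; rewrite !dotE.
set a := val xi 0 0; set b := val xi 1 0; set c := val xi 2%:R 0.
set a' := val y 0 0; set b' := val y 1 0; set c' := val y 2%:R 0.
set e := val eta 0 0; set f := val eta 1 0; set g := val eta 2%:R 0.
move=> hx hy he; set p := a * e + _ + _; set q := e * a' + _ + _.
have := cauchy_schwarz3 (a - p * e) (b - p * f) (c - p * g)
  (a' - q * e) (b' - q * f) (c' - q * g).
have -> : (a - p * e) * (a' - q * e) + (b - p * f) * (b' - q * f) +
    (c - p * g) * (c' - q * g) = a * a' + b * b' + c * c' - p * q.
  transitivity (a * a' + b * b' + c * c' - p * q +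
    p * q * (e * e + f * f + g * g - 1)); first by rewrite /p /q; ring.
  by rewrite he subrr mulr0 addr0.
have -> : (a - p * e) ^+ 2 + (b - p * f) ^+ 2 + (c - p * g) ^+ 2 = 1 - p ^+ 2.
  transitivity (a * a + b * b + c * c - p ^+ 2 +
    p ^+ 2 * (e * e + f * f + g * g - 1)); first by rewrite /p; ring.
  by rewrite hx he subrr mulr0 addr0.
have -> // : (a' - q * e) ^+ 2 + (b' - q * f) ^+ 2 + (c' - q * g) ^+ 2 = 1 - q ^+ 2.
transitivity (a' * a' + b' * b' + c' * c' - q ^+ 2 +
  q ^+ 2 * (e * e + f * f + g * g - 1)); first by rewrite /q; ring.
by rewrite hy he subrr mulr0 addr0.
Qed.

Lemma zkernel_bound n y eta xi : `|zkernel n y eta xi| <= 3 ^+ n.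
Proof.
have d1 := dot_sqr_le1 eta y; have s0 := sqr_ge0 (dot eta y).
have s1 : 0 <= 1 - dot xi eta ^+ 2 by rewrite subr_ge0 dot_sqr_le1.
apply: re_pow_bound; last by rewrite ger0_norm; lra.
have [e|ne] := eqVneq (1 - dot xi eta ^+ 2) 0.
  by rewrite e sqrtr0 invr0 mulr0 normr0.
rewrite normrM normfV [X in _ / X]ger0_norm ?sqrtr_ge0//.
rewrite ler_pdivrMr ?mul1r ?sqrtr_gt0 ?lt_def ?ne//.
rewrite -sqrtr_sqr ler_sqrt//; apply: (le_trans (dot_gram xi eta y)).
by rewrite ler_piMr//; lra.
Qed.

Lemma measurable_re_pow d (T : measurableType d) (f g : T -> R) n :
  measurable_fun setT f -> measurable_fun setT g ->
  measurable_fun setT (fun t => re_pow (f t) (g t) n).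
Proof.
move=> mf mg; suff : measurable_fun setT (fun t => re_pow (f t) (g t) n) /\
  measurable_fun setT (fun t => re_pow (f t) (g t) n.+1) by case.
elim: n => [|k [IH1 IH2]]; first by split => //; exact: measurable_cst.
split => //; apply: measurable_funB; last exact: measurable_funM.
by apply: measurable_funM => //; apply: measurable_funM.
Qed.

Lemma measurable_zkernel n y :
  measurable_fun setT (fun p : S2 R * S2 R => zkernel n y p.1 p.2).
Proof.
have md := @measurable_dot R _ (S2 R * S2 R)%type.
have m1 : measurable_fun setT (fun p : S2 R * S2 R => dot p.1 y).
  by apply: md => //; exact: measurable_cst.
have m2 : measurable_fun setT (fun p : S2 R * S2 R => dot p.2 y).
  by apply: md => //; exact: measurable_cst.
have m21 : measurable_fun setT (fun p : S2 R * S2 R => dot p.2 p.1) by exact: md.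
apply: measurable_re_pow; last first.
  by apply: measurable_funB; [exact: measurable_cst|exact: measurable_funX].
apply: measurable_funM.
  by apply: measurable_funB => //; exact: measurable_funM.
have -> : (fun p : S2 R * S2 R => (Num.sqrt (1 - dot p.2 p.1 ^+ 2))^-1) =
    (fun p : S2 R * S2 R => Num.sqrt (1 - dot p.2 p.1 ^+ 2) `^ (-1)).
  by apply/funext => p; rewrite powR_inv1// sqrtr_ge0.
apply: (measurableT_comp (measurable_powR (-1))).
apply: measurableT_comp.
  by apply: continuous_measurable_fun; exact: sqrt_continuous.
by apply: measurable_funB; [exact: measurable_cst|exact: measurable_funX].
Qed.

Lemma bounded_mfun_zkernel n y :
  bounded_mfun (fun p : S2 R * S2 R => zkernel n y p.1 p.2).
Proof.
split; first exact: measurable_zkernel.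
by exists (3 ^+ n) => p; exact: zkernel_bound.
Qed.

(** The integral of the [n]-th power of the sine of the distance to the north pole;
by invariance any other point of the sphere gives the same value. *)
Definition zonal_factor n : R :=
  \int[cone]_eta (Num.sqrt (1 - dot (Phi 0 0) eta ^+ 2) ^+ n).

Lemma north_dot x : dot (Phi 0 0) x = val x 2%:R 0.
Proof. by rewrite dotE PhiE !mxE/= sin0 cos0 !mulr0 !mul0r !add0r mul1r. Qed.

Lemma bounded_mfun_sine n :
  bounded_mfun (fun eta : S2 R => Num.sqrt (1 - dot (Phi 0 0) eta ^+ 2) ^+ n).
Proof.
apply: bounded_mfunX; split.
  apply: measurableT_comp.
    by apply: continuous_measurable_fun; exact: sqrt_continuous.
  apply: measurable_funB; first exact: measurable_cst.
  by apply: measurable_funX; apply: measurable_dot => //; exact: measurable_cst.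
exists 1 => eta; rewrite ger0_norm ?sqrtr_ge0// -[leRHS]sqrtr1 ler_sqrt//.
by rewrite gerBl sqr_ge0.
Qed.

Lemma sine_neq0 (eta : S2 R) : val eta 1 0 <> 0 ->
  Num.sqrt (1 - dot (Phi 0 0) eta ^+ 2) != 0.
Proof.
move=> eta1; rewrite gt_eqF// sqrtr_gt0 north_dot -(S2E eta) addrK.
rewrite lt_def addr_ge0 ?sqr_ge0// andbT paddr_eq0 ?sqr_ge0// !sqrf_eq0.
by rewrite negb_and orbC; move/eqP : eta1 => ->.
Qed.

(** The last rotation fixes the north pole, the first two are spherical coordinates. *)
Lemma Psi_north a b c : Psi_mx a b c *m Phi_vec 0 0 = Phi_vec a b :> 'cV[R]_3.
Proof.
have n3 : R3 c *m Phi_vec 0 0 = Phi_vec 0 0 :> 'cV[R]_3.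
  apply/matrixP => -[[|[|[|//]]] hi] j;
  by rewrite !mxE !big_ord_recl big_ord0 !mxE/= ?sin0 ?cos0; ring.
have n2 : R2 b *m Phi_vec 0 0 = Phi_vec 0 b :> 'cV[R]_3.
  apply/matrixP => -[[|[|[|//]]] hi] j;
  by rewrite !mxE !big_ord_recl big_ord0 !mxE/= ?sin0 ?cos0; ring.
rewrite /Psi_mx -mulmxA n3 -mulmxA n2.
apply/matrixP => -[[|[|[|//]]] hi] j;
by rewrite !mxE !big_ord_recl big_ord0 !mxE/= ?sin0 ?cos0; ring.
Qed.

Lemma rotT_axis a y :
  (val (rotT (Psi a 0 0) y) 0 0 = cos a * val y 0 0 + sin a * val y 1 0) *
  (val (rotT (Psi a 0 0) y) 1 0 = - sin a * val y 0 0 + cos a * val y 1 0) *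
  (val (rotT (Psi a 0 0) y) 2%:R 0 = val y 2%:R 0).
Proof.
have l1 : lift ord0 ord0 = 1 :> 'I_3 by exact: val_inj.
have l2 : lift ord0 (lift ord0 ord0) = 2%:R :> 'I_3 by exact: val_inj.
rewrite /= /Psi_mx R2_0 R3_0 !mulmx1.
split; first split.
- by rewrite !mxE !big_ord_recl big_ord0 !mxE/= l1; ring.
- by rewrite !mxE !big_ord_recl big_ord0 !mxE/= l1; ring.
- by rewrite !mxE !big_ord_recl big_ord0 !mxE/= l2; ring.
Qed.

Let I n y xi := \int[cone]_eta zkernel n y eta xi.

Let bounded_zkernel1 n y xi : bounded_mfun (fun eta => zkernel n y eta xi).
Proof. exact: (bounded_mfun_pair2 (bounded_mfun_zkernel n y)). Qed.

Let I_rotT n y xi a b c :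
  I n (rotT (Psi a b c) y) (rotT (Psi a b c) xi) = I n y xi.
Proof.
set A := Psi a b c; pose f eta := zkernel n (rotT A y) eta (rotT A xi).
transitivity (\int[cone]_eta f (rotT A eta)).
  apply/esym/Rintegral_invariant; [exact: measurable_rotT| |].
    by move=> B mB; exact: cone_measure_rotT.
  exact: bounded_zkernel1.
by apply: eq_Rintegral => eta _; rewrite /f zkernel_rotT.
Qed.

Let I_north n y : I n y (Phi 0 0) = zonal_factor n * (zonal n).[val y 2%:R 0].
Proof.
pose t j : R := pi *+ 2 / n.+1%:R *+ j.
have fixn (a : R) : rotT (Psi a 0 0) (Phi 0 0) = Phi 0 0.
  apply/val_inj; rewrite /= /Psi_mx R2_0 R3_0 !mulmx1.
  apply/matrixP => -[[|[|[|//]]] hi] j;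
  by rewrite !mxE !big_ord_recl big_ord0 !mxE/= ?sin0 ?cos0; ring.
have e1 : n.+1%:R * I n y (Phi 0 0) =
    \sum_(j < n.+1) I n (rotT (Psi (t j) 0 0) y) (Phi 0 0).
  rewrite -[n.+1 in LHS]card_ord mulr_natl -sumr_const.
  by apply: eq_bigr => j _; rewrite -{2}(fixn (t j)) I_rotT.
apply: (mulfI (x := n.+1%:R)); first by rewrite pnatr_eq0.
rewrite e1 /I -Rintegral_sum; last by move=> j; exact: bounded_zkernel1.
have bS := bounded_mfun_sine n.
transitivity (\int[cone]_eta (n.+1%:R * (zonal n).[val y 2%:R 0] *
    Num.sqrt (1 - dot (Phi 0 0) eta ^+ 2) ^+ n)); last first.
  rewrite RintegralZl//; first by rewrite -mulrA [X in _ * X]mulrC.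
  exact: bounded_mfun_integrable.
apply: (@Rintegral_ae _ _ _ _ _ _ [set x : S2 R | val x 1 0 = 0]).
- exact: measurable_meridian.
- exact: cone_measure_meridian.
- by apply: bounded_mfun_sum => j; exact: bounded_zkernel1.
- by apply: bounded_mfunM => //; exact: bounded_mfun_cst.
move=> eta /= eta1; set S := Num.sqrt _.
have hE := S2E eta; have hy := S2E y.
have S2' : S ^+ 2 = val eta 0 0 ^+ 2 + val eta 1 0 ^+ 2.
  rewrite sqr_sqrtr ?subr_ge0 ?dot_sqr_le1// north_dot -hE; ring.
have S0 : S != 0.
  apply: contra_notN eta1 => /eqP S0; move: S2'; rewrite S0 expr0n/= => /esym/eqP.
  by rewrite paddr_eq0 ?sqr_ge0// !sqrf_eq0 => /andP[_ /eqP].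
have := @re_pow_average R n (val eta 0 0) (val eta 1 0) (val eta 2%:R 0) S
  (val y 0 0) (val y 1 0) (val y 2%:R 0) S0 (esym S2').
rewrite S2' => /(_ hE hy) avg.
rewrite [RHS]mulrAC -mulrA -avg; apply: eq_bigr => j _.
rewrite /zkernel -/S !north_dot.
have -> : val (rotT (Psi (t j) 0 0) y) 2%:R 0 = val y 2%:R 0.
  rewrite -!north_dot -{1}(fixn (t j)) dot_rotT//.
have -> : dot eta (rotT (Psi (t j) 0 0) y) =
    val eta 0 0 * (cos (t j) * val y 0 0 + sin (t j) * val y 1 0) +
    val eta 1 0 * (- sin (t j) * val y 0 0 + cos (t j) * val y 1 0) +
    val eta 2%:R 0 * val y 2%:R 0.
  by rewrite dotE !rotT_axis.
by [].
Qed.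

(** The kernel is invariant under simultaneous rotations of its three arguments and
the measure is invariant, so [xi] may be taken to be the north pole.  The rotations
about the axis fix it, so [y] may be averaged over finitely many of them. *)
Lemma Rintegral_zkernel n y xi :
  \int[cone]_eta zkernel n y eta xi = zonal_factor n * (zonal n).[dot xi y].
Proof.
have [_ [phi xiE]] := zenE xi; set th := zen xi in xiE.
have north : rotT (Psi phi th 0) xi = Phi 0 0.
  apply: val_inj; rewrite /= xiE PhiE -[Phi_vec phi th](Psi_north _ _ 0) mulmxA.
  by have [-> _] := Psi_mxP phi th 0; rewrite mul1mx.
rewrite -/(I n y xi) -(I_rotT _ _ _ phi th 0) north I_north -north_dot -north.
by rewrite dot_rotT.
Qed.

(** The integrand vanishes at the poles only. *)
Lemma zonal_factor_gt0 n : 0 < zonal_factor n.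
Proof.
have f0 (eta : S2 R) : 0 <= Num.sqrt (1 - dot (Phi 0 0) eta ^+ 2) ^+ n.
  by rewrite exprn_ge0// sqrtr_ge0.
rewrite lt_def Rintegral_ge0// andbT; apply/eqP => e0.
have [N [mN N0 sN]] := Rintegral_eq0 (bounded_mfun_sine n) f0 e0.
have := @cone_measure_gt0 R; rewrite ltNge => /negP; apply.
pose M := [set x : S2 R | val x 1 0 = 0].
have mM : measurable M by exact: measurable_meridian.
apply: (@le_trans _ _ (cone (N `|` M))).
  apply: le_measure; rewrite ?inE//; first exact: measurableU.
  move=> eta _; have [e1|e1] := pselect (val eta 1 0 = 0); [by right|left].
  apply: contrapT => /sN /eqP; rewrite expf_eq0 => /andP[_].
  by rewrite (negbTE (sine_neq0 e1)).
have NM : (cone (N `|` M) <= cone N + cone M)%E by exact: measureU2.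
by apply: le_trans NM _; rewrite cone_measure_meridian N0 adde0.
Qed.

End zonal_kernel.

(** * Zonal integrals determine a finite measure on the sphere *)

Section bounded_limit.
Context d (T : measurableType d) (R : realType).

Lemma bounded_mfun_limit (f_ : nat -> T -> R) (f : T -> R) (M : R) :
  (forall n, measurable_fun setT (f_ n)) -> (forall n x, `|f_ n x| <= M) ->
  (forall x, f_ ^~ x @ \oo --> f x) -> bounded_mfun f.
Proof.
move=> mf_ M_ cf; split.
  by apply: (measurable_fun_cvg mf_) => x _; exact: cf.
exists M => x; have cnf : (`|f_ n x|) @[n --> \oo] --> `|f x|.
  by apply: cvg_norm; exact: cf.
rewrite -(cvg_lim _ cnf)//; apply: limr_le; first by apply/cvg_ex; exists `|f x|.
by apply: nearW => n; exact: M_.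
Qed.

(** Dominated convergence; convergence may fail on the null set [N]. *)
Lemma bounded_convergence (m : {finite_measure set T -> \bar R})
    (f_ : nat -> T -> R) (f : T -> R) (M : R) (N : set T) :
  measurable N -> m N = 0%E -> bounded_mfun f ->
  (forall n, measurable_fun setT (f_ n)) -> (forall n x, `|f_ n x| <= M) ->
  (forall x, ~ N x -> f_ ^~ x @ \oo --> f x) ->
  \int[m]_x f_ n x @[n --> \oo] --> \int[m]_x f x.
Proof.
move=> mN N0 bf mf_ M_ cf; have [mf _] := bf.
have [] := @dominated_convergence _ _ _ m setT measurableT
  (fun n x => (f_ n x)%:E) (EFin \o f) (cst M%:E).
- by move=> n; apply/measurable_EFinP.
- by apply/measurable_EFinP.
- exists N; split=> // x /= h; apply: contrapT => nN; apply: h => _.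
  by apply: cvg_EFin; [exact: nearW|exact: cf].
- by apply: bounded_mfun_integrable; exact: bounded_mfun_cst.
- by apply: aeW => x n _; rewrite lee_fin; exact: M_.
move=> _ _; rewrite -EFin_Rintegral// => /fine_cvg.
by apply: cvg_trans; apply: near_eq_cvg; apply: nearW => n.
Qed.

End bounded_limit.

Section agreement.
Context d (T : measurableType d) (R : realType).
Variables p q : {finite_measure set T -> \bar R}.

Definition agree (f : T -> R) := \int[p]_x f x = \int[q]_x f x.

Lemma agreeD f g : bounded_mfun f -> bounded_mfun g ->
  agree f -> agree g -> agree (fun x => f x + g x).
Proof.
move=> bf bg pf pg; rewrite /agree !RintegralD//; try exact: bounded_mfun_integrable.
by congr (_ + _).
Qed.

Lemma agreeZ c f : bounded_mfun f -> agree f -> agree (fun x => c * f x).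
Proof.
move=> bf pf; rewrite /agree !RintegralZl//; try exact: bounded_mfun_integrable.
by congr (_ * _).
Qed.

Lemma agree_sum I (r : seq I) (F : I -> T -> R) :
  (forall i, bounded_mfun (F i)) -> (forall i, agree (F i)) ->
  agree (fun x => \sum_(i <- r) F i x).
Proof.
move=> bF aF; rewrite /agree !Rintegral_sum//.
by apply: eq_bigr => i _; exact: aF.
Qed.

Lemma agree_limit (f_ : nat -> T -> R) (f : T -> R) (M : R) :
  (forall n, measurable_fun setT (f_ n)) -> (forall n x, `|f_ n x| <= M) ->
  (forall x, f_ ^~ x @ \oo --> f x) -> (forall n, agree (f_ n)) -> agree f.
Proof.
move=> mf_ M_ cf af_.
have bf := bounded_mfun_limit mf_ M_ cf.
have cvg_int m := @bounded_convergence _ _ _ m f_ f M set0 measurable0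
  (measure0 m) bf mf_ M_ (fun x _ => cf x).
have h1 := cvg_int p; have h2 := cvg_int q.
have e : (fun n => \int[p]_x f_ n x) = (fun n => \int[q]_x f_ n x).
  by apply/funext => n; exact: af_.
by rewrite e in h1; rewrite /agree -(cvg_lim _ h1)// -(cvg_lim _ h2).
Qed.

End agreement.

Section step_functions.
Context {R : realType}.
Implicit Types x t : R.

Lemma bernoulli_le t n : 0 <= t -> 1 + n%:R * t <= (1 + t) ^+ n.
Proof.
move=> t0; elim: n => [|n IH]; first by rewrite mul0r addr0 expr0.
rewrite exprS; apply: (le_trans _ (ler_wpM2l _ IH)); last by lra.
have : 0 <= n%:R * t * t :> R by rewrite !mulr_ge0.
by rewrite -natr1; nra.
Qed.

Lemma bernoulli_ge t n : 0 <= t <= 1 -> 1 - n%:R * t <= (1 - t) ^+ n.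
Proof.
move=> /andP[t0 t1]; elim: n => [|n IH]; first by rewrite mul0r subr0 expr0.
rewrite exprS; apply: (le_trans _ (ler_wpM2l _ IH)); last by lra.
have : 0 <= n%:R * t * t :> R by rewrite !mulr_ge0.
by rewrite -natr1; nra.
Qed.

(** This follows from [(1 - t) (1 + t) <= 1] and Bernoulli's inequality. *)
Lemma exp_one_sub_le t n : 0 <= t <= 1 -> (1 - t) ^+ n <= (1 + n%:R * t)^-1.
Proof.
move=> /andP[t0 t1]; have nt : 0 <= n%:R * t by rewrite mulr_ge0.
rewrite -[leRHS]mul1r ler_pdivlMr; last by lra.
apply: (le_trans (ler_wpM2l _ (bernoulli_le n t0))).
  by rewrite exprn_ge0//; lra.
rewrite -exprMn exprn_ile1//; first by nra.
by nra.
Qed.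

Lemma cvg_natmul_expr x : 0 < x < 1 -> (n%:R * x ^+ n) @[n --> \oo] --> (0 : R).
Proof.
move=> /andP[x0 x1]; pose y := Num.sqrt x.
have y0 : 0 < y by rewrite sqrtr_gt0.
have y1 : y < 1 by rewrite -[ltRHS]sqrtr1 ltr_sqrt.
have yx : y ^+ 2 = x by rewrite sqr_sqrtr// ltW.
pose e := y^-1 - 1.
have ey : 1 + e = y^-1 by rewrite /e addrC subrK.
have e0 : 0 < e by rewrite subr_gt0 invf_gt1.
have b n : n%:R * y ^+ n <= e^-1.
  rewrite -[leRHS]mul1r ler_pdivlMr// mulrAC.
  have := bernoulli_le n (ltW e0); rewrite ey exprVn => h.
  have yn : 0 < y ^+ n by rewrite exprn_gt0.
  rewrite -[leRHS](mulVf (lt0r_neq0 yn)) ler_wpM2r ?ltW//.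
  by lra.
apply: (@squeeze_cvgr _ _ _ _ (fun=> 0) (fun n => e^-1 * y ^+ n)).
- apply: nearW => n; rewrite mulr_ge0 ?exprn_ge0 ?(ltW x0)//=.
  have -> : x ^+ n = y ^+ n * y ^+ n by rewrite -yx -exprM mul2n -addnn exprD.
  by rewrite mulrA ler_wpM2r// exprn_ge0// ltW.
- exact: cvg_cst.
- rewrite -[X in _ --> X](mulr0 e^-1); apply: cvgMr.
  by apply: cvg_expr; rewrite ger0_norm// ltW.
Qed.

(** Put [x = K s].  The expression lies between [1 - n x ^ n] and
[1 / (1 + n x ^ n)].  The factor [n] in the exponent makes the limit [0] also at
the threshold [x = 1]. *)
Lemma cvg_step (K : nat) (s : R) : (0 < K)%N -> 0 < s <= 1 ->
  ((1 - s ^+ n) ^+ (n * K ^ n)) @[n --> \oo] --> ((K%:R * s < 1)%R%:R : R).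
Proof.
move=> K0 /andP[s0 s1]; set x := K%:R * s.
have x0 : 0 < x by rewrite mulr_gt0// ltr0n.
have sn n : 0 <= s ^+ n <= 1 by rewrite exprn_ge0 ?(ltW s0)//= exprn_ile1// ltW.
have xE n : (n * K ^ n)%:R * s ^+ n = n%:R * x ^+ n.
  by rewrite natrM natrX -mulrA -exprMn.
have hi n : (1 - s ^+ n) ^+ (n * K ^ n) <= (1 + n%:R * x ^+ n)^-1.
  by rewrite -xE exp_one_sub_le.
have lo n : 1 - n%:R * x ^+ n <= (1 - s ^+ n) ^+ (n * K ^ n).
  by rewrite -xE bernoulli_ge.
have p0 n : 0 <= (1 - s ^+ n) ^+ (n * K ^ n).
  by rewrite exprn_ge0// subr_ge0; have /andP[] := sn n.
have p1 n : (1 - s ^+ n) ^+ (n * K ^ n) <= 1.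
  have /andP[? ?] := sn n.
  by rewrite exprn_ile1//; lra.
case: (ltP x 1) => x1 /=.
  apply: (@squeeze_cvgr _ _ _ _ (fun n => 1 - n%:R * x ^+ n) (fun=> 1)).
  - by apply: nearW => n; rewrite lo p1.
  - rewrite -[X in _ --> X]subr0; apply: cvgB; first exact: cvg_cst.
    by apply: cvg_natmul_expr; rewrite x0.
  - exact: cvg_cst.
apply: (@squeeze_cvgr _ _ _ _ (fun=> 0) (fun n => n.+1%:R^-1)).
- apply: nearW => n; rewrite p0 /=; apply: (le_trans (hi n)).
  have nx : n%:R <= n%:R * x ^+ n :> R by rewrite ler_peMr// exprn_ege1.
  rewrite lef_pV2 ?posrE ?ltr0Sn//; last by have := ler0n R n; lra.
  by rewrite -natr1; lra.
- exact: cvg_cst.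
- exact: cvg_harmonic.
Qed.

End step_functions.

Section bounded_dot.
Context {R : realType}.

Lemma bounded_mfun_dot (y : S2 R) : bounded_mfun (fun xi => dot xi y).
Proof.
split; first by apply: measurable_dot => //; exact: measurable_cst.
by exists 1 => xi; exact: dot_norm_le1.
Qed.

Lemma bounded_mfun_poly_dot (r : {poly R}) (y : S2 R) : bounded_mfun (fun xi => r.[dot xi y]).
Proof.
under eq_fun do rewrite horner_coef.
apply: bounded_mfun_sum => i; apply: bounded_mfunM; first exact: bounded_mfun_cst.
by apply: bounded_mfunX; exact: bounded_mfun_dot.
Qed.

End bounded_dot.

Section zonal_moments_determine.
Context {R : realType}.
Variables p q : {finite_measure set (S2 R) -> \bar R}.
Implicit Types (xi y : S2 R) (v w : R * R * R) (r : {poly R}).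

Let agr := @agree _ (S2 R) R p q.

Hypothesis zonal_agree : forall n y, agr (fun xi => (zonal n).[dot xi y]).

Let bounded_dot := @bounded_mfun_dot R.
Let bounded_poly := @bounded_mfun_poly_dot R.

(** Induction on the degree: subtracting the right multiple of [zonal n] lowers the
degree of [r], as [zonal n] has degree exactly [n]. *)
Let poly_agree n r y : (size r <= n)%N -> agr (fun xi => r.[dot xi y]).
Proof.
elim: n r => [|n IH] r sr.
  move: sr; rewrite leqn0 size_poly_eq0 => /eqP ->.
  rewrite /agr /agree; under eq_Rintegral do rewrite horner0.
  under [RHS]eq_Rintegral do rewrite horner0.
  by rewrite !Rintegral_cst// !mul0r.
have [zs z0] := @zonal_lead R n; pose c := r`_n / (zonal n)`_n.
pose r' := r - c *: zonal n.
have sr' : (size r' <= n)%N.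
  apply/leq_sizeP => j; rewrite leq_eqVlt => /predU1P[<-|nj].
    by rewrite coefB coefZ /c divfK ?subrr// gt_eqF.
  by rewrite coefB coefZ !nth_default ?mulr0 ?subrr//; [exact: leq_trans zs _|exact: leq_trans sr _].
have -> : (fun xi => r.[dot xi y]) =
    (fun xi => r'.[dot xi y] + c * (zonal n).[dot xi y]).
  by apply/funext => xi; rewrite /r' !hornerE subrK.
apply: agreeD => //; first by apply: bounded_mfunM => //; exact: bounded_mfun_cst.
- exact: IH.
- by apply: agreeZ; [exact: bounded_mfun_poly_dot|exact: zonal_agree].
Qed.

Let lin v xi := v.1.1 * val xi 0 0 + v.1.2 * val xi 1 0 + v.2 * val xi 2%:R 0.

(** Scaling removes the restriction to unit vectors. *)
Let linE v xi : lin v xi = Num.sqrt (sqnorm3 v) * dot xi (radial v).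
Proof.
have n0 : 0 <= sqnorm3 v by rewrite !addr_ge0 ?sqr_ge0.
have [v0|v0] := ltP 0 (sqnorm3 v).
  rewrite dotE (radialE v0) !mxE/= /lin.
  have s0 : Num.sqrt (sqnorm3 v) != 0 by rewrite gt_eqF// sqrtr_gt0.
  by field.
have e0 : sqnorm3 v = 0 by apply/eqP; rewrite eq_le v0.
rewrite e0 sqrtr0 mul0r /lin; move: e0; rewrite /sqnorm3 => /eqP.
rewrite !paddr_eq0 ?addr_ge0 ?sqr_ge0// !sqrf_eq0.
by move=> /andP[/andP[/eqP-> /eqP->] /eqP->]; rewrite !mul0r !addr0.
Qed.

Let bounded_lin v : bounded_mfun (lin v).
Proof.
have -> : lin v = fun xi => Num.sqrt (sqnorm3 v) * dot xi (radial v).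
  by apply/funext => xi; rewrite linE.
by apply: bounded_mfunM => //; exact: bounded_mfun_cst.
Qed.

Let lin_norm v xi : `|lin v xi| <= Num.sqrt (sqnorm3 v).
Proof.
rewrite linE normrM ger0_norm ?sqrtr_ge0// ler_piMr ?sqrtr_ge0//.
exact: dot_norm_le1.
Qed.

Let lin_agree v n : agr (fun xi => lin v xi ^+ n).
Proof.
have -> : (fun xi => lin v xi ^+ n) = (fun xi =>
    Num.sqrt (sqnorm3 v) ^+ n * ('X^n : {poly R}).[dot xi (radial v)]).
  by apply/funext => xi; rewrite linE exprMn hornerXn.
by apply: agreeZ => //; exact: poly_agree.
Qed.

Let ex v xi := expR (lin v xi).

Let exD v w xi : ex (v + w) xi = ex v xi * ex w xi.
Proof. by rewrite /ex -expRD /lin/=; congr expR; ring. Qed.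

Let bounded_ex v : bounded_mfun (ex v).
Proof.
split; first by apply: measurableT_comp => //; case: (bounded_lin v).
exists (expR (Num.sqrt (sqnorm3 v))) => xi.
rewrite ger0_norm ?expR_ge0// ler_expR.
by apply: le_trans (ler_norm _) (lin_norm v xi).
Qed.

(** The partial sums of the exponential series are dominated by the exponential of
the norm of [v], since [xi] is a unit vector. *)
Let ex_agree v : agr (ex v).
Proof.
apply: (@agree_limit _ _ _ p q
  (fun n xi => series (exp_coeff (lin v xi)) n) _
  (expR (Num.sqrt (sqnorm3 v)))).
- move=> n; apply: measurable_sum => k; apply: measurable_funM => //.
  by apply: measurable_funX; case: (bounded_lin v).
- move=> n xi; apply: (@le_trans _ _ (series (exp_coeff (Num.sqrt (sqnorm3 v))) n)).
    rewrite /series/=; apply: (le_trans (ler_norm_sum _ _ _)).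
    apply: ler_sum => k _; rewrite /exp_coeff/= normrM normrX.
    rewrite [X in _ * X <= _]ger0_norm ?invr_ge0// ler_wpM2r ?invr_ge0//.
    by rewrite lerXn2r// ?nnegrE ?sqrtr_ge0.
  apply: nondecreasing_cvgn_le; last exact: is_cvg_series_exp_coeff.
  apply/nondecreasing_seqP => k; rewrite /series/= big_nat_recr//= lerDl.
  by rewrite exp_coeff_ge0// sqrtr_ge0.
- move=> xi; exact: is_cvg_series_exp_coeff.
- move=> n; apply: (@agree_sum _ _ _ p q _ _
    (fun k xi => lin v xi ^+ k / k`!%:R)) => k.
    by apply: bounded_mfunM; [exact: bounded_mfunX|exact: bounded_mfun_cst].
  have -> : (fun xi => lin v xi ^+ k / k`!%:R) =
      (fun xi => k`!%:R^-1 * lin v xi ^+ k).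
    by apply/funext => xi; rewrite mulrC.
  by apply: agreeZ; [exact: bounded_mfunX|exact: lin_agree].
Qed.

(** This property, unlike [agr], is stable under multiplication by exponentials. *)
Let exp_agree (f : S2 R -> R) :=
  bounded_mfun f /\ forall v, agr (fun xi => f xi * ex v xi).

Let exp_agree1 : exp_agree (fun=> 1).
Proof.
split=> [|v]; first exact: bounded_mfun_cst.
by under eq_fun do rewrite mul1r; exact: ex_agree.
Qed.

Let exp_agree_step f c w n : exp_agree f ->
  exp_agree (fun xi => f xi * (1 - c * ex w xi) ^+ n).
Proof.
move=> af; elim: n => [|n [bf IH]].
  by under eq_fun do rewrite expr0 mulr1.
have b1 : bounded_mfun (fun xi => 1 - c * ex w xi).
  apply: bounded_mfunB; first exact: bounded_mfun_cst.
  by apply: bounded_mfunM => //; exact: bounded_mfun_cst.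
split => [|v].
  by apply: bounded_mfunM; [case: af|exact: bounded_mfunX].
have -> : (fun xi => f xi * (1 - c * ex w xi) ^+ n.+1 * ex v xi) =
    (fun xi => f xi * (1 - c * ex w xi) ^+ n * ex v xi +
      - c * (f xi * (1 - c * ex w xi) ^+ n * ex (w + v) xi)).
  by apply/funext => xi; rewrite exD exprS; ring.
apply: agreeD => //.
- exact: bounded_mfunM.
- by apply: bounded_mfunM; [exact: bounded_mfun_cst|exact: bounded_mfunM].
- exact: IH.
- apply: (@agreeZ _ _ _ p q (- c)
    (fun xi => f xi * (1 - c * ex w xi) ^+ n * ex (w + v) xi)).
    exact: bounded_mfunM.
  exact: IH.
Qed.

(** Multiplying by [(1 - s ^ n) ^ (n K ^ n)] with [s = exp (lin w xi - a) / K] is a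
step of the previous kind, because [s ^ n] is a multiple of the exponential of
[n w]; then [n] tends to infinity.  [K] is large enough for [s <= 1]. *)
Let exp_agree_halfspace f w a : exp_agree f ->
  exp_agree (fun xi => f xi * (lin w xi < a)%R%:R).
Proof.
move=> af; pose K := (Num.trunc (expR (Num.sqrt (sqnorm3 w) - a))).+1.
have K1 : expR (Num.sqrt (sqnorm3 w) - a) < K%:R by exact: truncnS_gt.
have K0 : 0 < K%:R :> R by rewrite ltr0n.
pose s xi := expR (lin w xi - a) / K%:R.
have s01 xi : 0 < s xi <= 1.
  rewrite divr_gt0 ?expR_gt0//= ler_pdivrMr// mul1r ltW//.
  apply: le_lt_trans K1; rewrite ler_expR lerB//.
  exact: le_trans (ler_norm _) (lin_norm w xi).
pose g n xi := f xi * (1 - s xi ^+ n) ^+ (n * K ^ n).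
have gE n : g n = fun xi => f xi *
    (1 - (expR (- a) / K%:R) ^+ n * ex (w *+ n) xi) ^+ (n * K ^ n).
  apply/funext => xi; rewrite /g; congr (_ * (1 - _) ^+ _).
  have -> : ex (w *+ n) xi = ex w xi ^+ n.
    elim: (n) => [|k IH]; last by rewrite mulrS exD exprS IH.
    by rewrite expr0 /ex /lin mulr0n/= !mul0r !addr0 expR0.
  by rewrite -exprMn /s expRD; congr (_ ^+ _); rewrite /ex; ring.
have ag n : exp_agree (g n) by rewrite gE; exact: exp_agree_step.
have cg xi : g n xi @[n --> \oo] --> f xi * (lin w xi < a)%R%:R.
  apply: cvgMr; have := @cvg_step _ K _ isT (s01 xi).
  suff -> : (K%:R * s xi < 1) = (lin w xi < a) by [].
  by rewrite /s mulrCA divff ?gt_eqF// mulr1 -expR0 ltr_expR subr_lt0.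
have [bf _] := af; have [mf [M fM]] := bf.
have gM n xi : `|g n xi| <= M.
  rewrite normrM -[leRHS]mulr1 ler_pM//.
  have /andP[s0 s1] := s01 xi.
  have sn0 : 0 <= s xi ^+ n by rewrite exprn_ge0// ltW.
  have sn1 : s xi ^+ n <= 1 by rewrite exprn_ile1// ltW.
  rewrite normrX exprn_ile1// ger0_norm; lra.
have bg : bounded_mfun (fun xi => f xi * (lin w xi < a)%R%:R).
  by apply: (bounded_mfun_limit _ gM cg) => n; case: (ag n) => -[].
split => // v; have [mv [N vN]] := bounded_ex v.
apply: (@agree_limit _ _ _ p q (fun n xi => g n xi * ex v xi) _ (M * N)).
- by move=> n; apply: measurable_funM => //; case: (ag n) => -[].
- by move=> n xi; rewrite normrM ler_pM.
- by move=> xi; apply: cvgMl; exact: cg.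
- by move=> n; have [_ h] := ag n; exact: h.
Qed.

(** Applying [exp_agree_halfspace] to the three coordinates gives agreement on the
boxes in [G]. *)
Lemma zonal_moments_determine B : measurable B -> p B = q B.
Proof.
pose G : set (set (S2 R)) := [set A | exists a b c : R,
  A = [set xi : S2 R | [/\ val xi 0 0 < a, val xi 1 0 < b & val xi 2%:R 0 < c]]].
have mlt i (a : R) : measurable [set xi : S2 R | val xi i 0 < a].
  have := @measurable_S2_coord R i measurableT `]-oo, a[%classic (measurable_itv _).
  by rewrite setTI.
have mG : G `<=` measurable.
  move=> _ [a [b [c ->]]]; set A := (X in measurable X).
  have -> : A = [set xi : S2 R | val xi 0 0 < a] `&`
     ([set xi : S2 R | val xi 1 0 < b] `&` [set xi : S2 R | val xi 2%:R 0 < c]).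
    by apply/seteqP; split => xi /=; [case|case=> ? []].
  by apply: measurableI => //; exact: measurableI.
have lt2 i xi : val xi i 0 < 2.
  suff : val xi i 0 ^+ 2 <= 1 by nra.
  rewrite -[leRHS](S2P xi) (bigD1 i)//= lerDl.
  by apply: sumr_ge0 => j _; exact: sqr_ge0.
(* Coordinates are at most 1, so 2 imposes no restriction. *)
have GT : G setT.
  by exists 2, 2, 2; apply/seteqP; split => // xi _ /=; split; exact: lt2.
have GI : setI_closed G.
  move=> _ _ [a [b [c ->]]] [a' [b' [c' ->]]].
  exists (Num.min a a'), (Num.min b b'), (Num.min c c'); apply/seteqP.
  split => xi /=; rewrite !lt_min.
    by move=> [[-> -> ->] [-> -> ->]].
  by move=> [/andP[-> ->] /andP[-> ->] /andP[-> ->]].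
have pqG A : G A -> p A = q A.
  move=> GA; have mA := mG _ GA; move: GA => [a [b [c AE]]].
  rewrite -!EFin_Rintegral_indic//; congr (_%:E).
  have [_ /(_ 0)] := exp_agree_halfspace ((0, 0), 1) c
    (exp_agree_halfspace ((0, 1), 0) b
    (exp_agree_halfspace ((1, 0), 0) a exp_agree1)).
  suff -> : (fun xi => 1 * (lin ((1, 0), 0) xi < a)%R%:R *
      (lin ((0, 1), 0) xi < b)%R%:R * (lin ((0, 0), 1) xi < c)%R%:R * ex 0 xi) =
      \1_A by [].
  apply/funext => xi; rewrite /ex /lin/= !mul0r !mul1r !(addr0, add0r) expR0 mulr1.
  rewrite indicE -!natrM !mulnb; congr (nat_of_bool _)%:R; apply/esym.
  apply/idP/idP; first by rewrite inE AE /= => -[-> -> ->].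
  by rewrite inE AE /= => /andP[/andP[-> ->] ->].
move=> mB.
apply: (@g_sigma_algebra_measure_unique _ R (S2 R) G mG (fun=> setT)) => //.
- by rewrite bigcup_const//; exists 0%N.
- by move=> _; rewrite -ge0_fin_numE// fin_num_measure.
have : measurable_fun setT (id : g_sigma_algebraType G -> S2 R).
  apply: measurable_to_S2 => i.
  apply: (measurability _ (RGenInftyO.measurableE R)).
  move=> _ [_ [a ->] <-]; rewrite setTI; apply: sub_sigma_algebra.
  have [->|[->|->]] : i = 0 \/ i = 1 \/ i = 2%:R.
    by case: i => -[|[|[|//]]] hi; [left|right; left|right; right]; exact: val_inj.
  - exists a, 2, 2; apply/seteqP; split => xi /=; rewrite in_itv/=; last by case.
    by move=> ?; split => //; exact: lt2.
  - exists 2, a, 2; apply/seteqP; split => xi /=; rewrite in_itv/=; last by case.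
    by move=> ?; split => //; exact: lt2.
  - exists 2, 2, a; apply/seteqP; split => xi /=; rewrite in_itv/=; last by case.
    by move=> ?; split => //; exact: lt2.
by move=> /(_ measurableT _ mB); rewrite setTI.
Qed.

End zonal_moments_determine.

(** * Frames of the semicircle transform *)

Section transform_geometry.
Context {R : realType}.
Implicit Types (x y xi eta : S2 R) (A : SO3 R) (a b c : R) (n : nat).

Lemma Phi_azi_zen x : Phi (azi x) (zen x) = x.
Proof.
have [_ [phi xE]] := zenE x; have [e0 e1 e2] := (Phi_eqP _ _ _).1 xE.
have z1 : 0 <= zen x <= pi.
  have h := S2E x; have [-> _] := zenE x.
  by rewrite acos_ge0 ?acos_lepi//; apply/andP; split; nra.
have s0 := sin_ge0_pi z1; have cs := cos2Dsin2 (zen x).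
have sE : Num.sqrt (val x 0 0 ^+ 2 + val x 1 0 ^+ 2) = sin (zen x).
  rewrite -[RHS]ger0_norm// -sqrtr_sqr; congr Num.sqrt.
  rewrite e0 e1.
  transitivity ((cos phi ^+ 2 + sin phi ^+ 2) * sin (zen x) ^+ 2); first by ring.
  by rewrite cos2Dsin2 mul1r.
apply/esym/Phi_eqP; rewrite aziE -sE.
have [r0|r0] := eqVneq (val x 0 0 ^+ 2 + val x 1 0 ^+ 2) 0.
  rewrite r0 sqrtr0 !mulr0; move/eqP: r0.
  by rewrite paddr_eq0 ?sqr_ge0// !sqrf_eq0 => /andP[/eqP -> /eqP ->].
by have [_ h0 h1] := azi_funP r0; split; rewrite // mulrC.
Qed.

Lemma rotT_north (eta : S2 R) c : rotT (Psi (azi eta) (zen eta) c) eta = Phi 0 0.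
Proof.
apply: val_inj; rewrite /= -[in val eta](Phi_azi_zen eta) PhiE.
rewrite -[X in _ *m X](Psi_north _ _ c) mulmxA.
by have [-> _] := Psi_mxP (azi eta) (zen eta) c; rewrite mul1mx.
Qed.

Lemma rotT_T_W_pole eta xi : rotT (T_W (eta, xi)) eta = Phi 0 0.
Proof. exact: rotT_north. Qed.

Lemma T_W_dot_pole eta xi y : val (rotT (T_W (eta, xi)) y) 2%:R 0 = dot eta y.
Proof. by rewrite -north_dot -(rotT_T_W_pole eta xi) dot_rotT. Qed.

(** The third Euler angle is by definition the azimuth of [xi] in the frame given by
the first two, so the last rotation turns [xi] into the half plane of azimuth [0]. *)
Lemma T_W_semicircle eta xi : dot xi eta ^+ 2 != 1 ->
  (val (rotT (T_W (eta, xi)) xi) 0 0 = Num.sqrt (1 - dot xi eta ^+ 2)) *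
  (val (rotT (T_W (eta, xi)) xi) 1 0 = 0).
Proof.
move=> d1; pose a := azi eta; pose b := zen eta.
pose z := rotT (Psi a b 0) xi; pose c := azi z.
rewrite -[T_W _]/(Psi a b c).
have -> : rotT (Psi a b c) xi = rotT (Psi c 0 0) z.
  rewrite /z (rotT_Psi a b c) (rotT_Psi a b 0); congr rotT.
  move: (rotT (Psi 0 b 0) _) => w; apply: val_inj.
  by rewrite /= /Psi_mx R2_0 R3_0 !mulmx1 trmx1 mul1mx.
have z2 : val z 2%:R 0 = dot xi eta.
  by rewrite -north_dot -(rotT_north eta 0) dot_rotT dotC.
have N2 : val z 0 0 ^+ 2 + val z 1 0 ^+ 2 = 1 - dot xi eta ^+ 2.
  by rewrite -z2 -(S2E z); ring.
have N0 : val z 0 0 ^+ 2 + val z 1 0 ^+ 2 != 0.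
  by rewrite N2 subr_eq0 eq_sym.
have [_] := azi_funP N0; rewrite -aziE -/c N2.
set S := Num.sqrt _ => z0 z1; have cs := cos2Dsin2 c.
have [[r0 r1] _] := rotT_axis c z.
rewrite r0 r1 z0 z1; split; last by ring.
by transitivity (S * (cos c ^+ 2 + sin c ^+ 2)); [ring|rewrite cs mulr1].
Qed.

Definition frame_kernel n y A : R :=
  re_pow (val (rotT A y) 0 0) (1 - val (rotT A y) 2%:R 0 ^+ 2) n.

(** In the frame, [xi] has coordinates [(S, 0, <xi, eta>)]; expanding [<xi, y>] in
this frame gives the first coordinate of [y]. *)
Lemma frame_kernel_T_W n y eta xi : dot xi eta ^+ 2 != 1 ->
  frame_kernel n y (T_W (eta, xi)) = zkernel n y eta xi.
Proof.
move=> d1; rewrite /frame_kernel /zkernel; have [s0 s1] := T_W_semicircle d1.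
have S0 : Num.sqrt (1 - dot xi eta ^+ 2) != 0.
  rewrite sqrtr_eq0 -ltNge subr_gt0 lt_neqAle d1.
  exact: dot_sqr_le1.
rewrite T_W_dot_pole; congr re_pow.
have := dot_rotT (T_W (eta, xi)) xi y; rewrite dotE s0 s1 mul0r addr0.
rewrite !T_W_dot_pole (dotC eta xi) => <-; rewrite addrK.
by rewrite mulrAC divff// mul1r.
Qed.

End transform_geometry.

(** * Injectivity on finite measures *)

Section rotation_functions.
Context {R : realType}.
Implicit Types (x y xi eta : S2 R) (A : SO3 R) (n : nat).

Lemma measurable_SO3_coord i j : measurable_fun setT (fun A : SO3 R => val A i j).
Proof.
apply: (measurability _ (RGenOpens.measurableE R)).
move=> _ [_ [a [b ->] <-]]; rewrite setTI; apply: sub_sigma_algebra.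
apply: (@measurable_coord _ _ _ (@SO3_set R) i j).
exact: interval_open.
Qed.

Definition pole A : S2 R := insubd (Phi 0 0) (val A *m Phi_vec 0 0).

Lemma poleE A : val (pole A) = val A *m Phi_vec 0 0.
Proof.
have [AA dA] := SO3P A.
have h : SO3_set (val A)^T.
  by split; rewrite ?det_tr// trmxK; exact: mulmx1C.
rewrite val_insubd ifT//; apply/mem_set.
by rewrite -(trmxK (val A)); apply: sphere_trmul => //; exact: Phi_vecP.
Qed.

Lemma measurable_pole : measurable_fun setT pole.
Proof.
apply: measurable_to_S2 => i; under eq_fun do rewrite poleE.
apply: (measurable_mulmx (A := fun A : SO3 R => val A)
  (B := fun=> Phi_vec 0 0)) => k j; first exact: measurable_SO3_coord.
exact: measurable_cst.
Qed.

Lemma pole_T_W eta xi : pole (T_W (eta, xi)) = eta.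
Proof. by apply: val_inj; rewrite poleE /= Psi_north -PhiE Phi_azi_zen. Qed.

Lemma S2_coord_sqr_le1 x i : val x i 0 ^+ 2 <= 1.
Proof.
rewrite -[leRHS](S2P x) (bigD1 i)//= lerDl.
by apply: sumr_ge0 => j _; exact: sqr_ge0.
Qed.

Lemma frame_kernel_bound n y A : `|frame_kernel n y A| <= 3 ^+ n.
Proof.
apply: re_pow_bound.
  by rewrite -(@ler_pXn2r _ 2)// ?nnegrE// expr1n -normrX ger0_norm ?sqr_ge0//;
    exact: S2_coord_sqr_le1.
have := S2_coord_sqr_le1 (rotT A y) 2%:R.
by have := sqr_ge0 (val (rotT A y) 2%:R 0) => h0 h1; rewrite ger0_norm; lra.
Qed.

Lemma bounded_mfun_frame_kernel n y : bounded_mfun (frame_kernel n y).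
Proof.
split; last by exists (3 ^+ n); exact: frame_kernel_bound.
have mc i : measurable_fun setT (fun A : SO3 R => val (rotT A y) i 0).
  apply: (measurable_mulmx (A := fun A : SO3 R => (val A)^T)
    (B := fun=> val y)) => k j; last exact: measurable_cst.
  by under eq_fun do rewrite mxE; exact: measurable_SO3_coord.
apply: measurable_re_pow; first exact: mc.
by apply: measurable_funB; [exact: measurable_cst|apply: measurable_funX; exact: mc].
Qed.

End rotation_functions.

Section nonnegative_injectivity.
Context {R : realType}.
Implicit Types (x y xi eta : S2 R) (A : SO3 R) (n : nat).
Local Notation u := (@uniform_S2 R).
Local Notation cone := (@cone_measure R).

Lemma azi_zen_interior eta : val eta 1 0 != 0 ->
  (0 < azi eta < 2 * pi) * (0 < zen eta < pi).
Proof.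
move=> eta1; have [_ e1 _] := (Phi_eqP _ _ _).1 (esym (Phi_azi_zen eta)).
have sn : sin (azi eta) * sin (zen eta) != 0 by rewrite -e1.
rewrite mulf_eq0 negb_or in sn; have /andP[sa sz] := sn.
have z1 : 0 <= zen eta <= pi.
  have h := S2E eta; have [-> _] := zenE eta.
  by rewrite acos_ge0 ?acos_lepi//; apply/andP; split; nra.
have r0 : val eta 0 0 ^+ 2 + val eta 1 0 ^+ 2 != 0.
  by rewrite paddr_eq0 ?sqr_ge0// !sqrf_eq0 (negbTE eta1) andbF.
have [a1 _ _] := azi_funP r0; rewrite -aziE in a1.
move: a1 z1 => /andP[a0 ->] /andP[z0 z1]; rewrite andbT !lt_def a0 z0 z1 !andbT.
split; last (apply/andP; split).
- by apply: contraNneq sa => ->; rewrite sin0.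
- by apply: contraNneq sz => ->; rewrite sin0.
- by apply: contraNneq sz => <-; rewrite sinpi.
Qed.

Lemma cvg_dot_Phi x eta (s t : nat -> R) :
  s @ \oo --> azi eta -> t @ \oo --> zen eta ->
  dot x (Phi (s k) (t k)) @[k --> \oo] --> dot x eta.
Proof.
move=> cs ct; rewrite -[in X in _ --> X](Phi_azi_zen eta).
have dE a b : dot x (Phi a b) = val x 0 0 * (cos a * sin b) +
    val x 1 0 * (sin a * sin b) + val x 2%:R 0 * cos b.
  by rewrite dotE PhiE !mxE.
rewrite dE; under eq_fun do rewrite dE.
have cos_s : cos (s k) @[k --> \oo] --> cos (azi eta).
  by apply: continuous_cvg cs; exact: continuous_cos.
have sin_s : sin (s k) @[k --> \oo] --> sin (azi eta).
  by apply: continuous_cvg cs; exact: continuous_sin.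
have cos_t : cos (t k) @[k --> \oo] --> cos (zen eta).
  by apply: continuous_cvg ct; exact: continuous_cos.
have sin_t : sin (t k) @[k --> \oo] --> sin (zen eta).
  by apply: continuous_cvg ct; exact: continuous_sin.
apply: cvgD; last by apply: cvgMr.
by apply: cvgD; apply: cvgMr; exact: cvgM.
Qed.

Lemma cvg_re_pow (a r : nat -> R) a0 r0 n : a @ \oo --> a0 -> r @ \oo --> r0 ->
  re_pow (a k) (r k) n @[k --> \oo] --> re_pow a0 r0 n.
Proof.
move=> ca cr; suff : (re_pow (a k) (r k) n @[k --> \oo] --> re_pow a0 r0 n) /\
  (re_pow (a k) (r k) n.+1 @[k --> \oo] --> re_pow a0 r0 n.+1) by case.
elim: n => [|n [IH1 IH2]]; first by split => //; exact: cvg_cst.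
split => //; apply: cvgB; last exact: cvgM.
by apply: cvgM => //; apply: cvgMr.
Qed.

(** The hypothesis on [xi] keeps the denominator away from [0]. *)
Lemma cvg_zkernel n y xi eta (e_ : nat -> S2 R) :
  (forall x, dot x (e_ k) @[k --> \oo] --> dot x eta) ->
  dot xi eta ^+ 2 != 1 ->
  zkernel n y (e_ k) xi @[k --> \oo] --> zkernel n y eta xi.
Proof.
move=> ce d1.
have cy : dot (e_ k) y @[k --> \oo] --> dot eta y.
  by rewrite dotC; under eq_fun do rewrite dotC; exact: ce.
have sq (f : nat -> R) (l : R) : f @ \oo --> l -> (1 - f k ^+ 2) @[k --> \oo] --> 1 - l ^+ 2.
  move=> fl; apply: cvgB; first exact: cvg_cst.
  by rewrite expr2; under eq_fun do rewrite expr2; exact: cvgM.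
apply: cvg_re_pow; last exact: sq.
apply: cvgM.
  by apply: cvgB; [exact: cvg_cst|apply: cvgM].
apply: cvgV.
  by rewrite sqrtr_eq0 -ltNge subr_gt0 lt_neqAle d1 dot_sqr_le1.
by apply: continuous_cvg; [exact: sqrt_continuous|exact/sq/ce].
Qed.

Lemma measurable_dot_sqr1 xi : measurable [set eta | dot xi eta ^+ 2 = 1].
Proof.
have : measurable_fun setT (fun eta : S2 R => dot xi eta ^+ 2).
  by apply: measurable_funX; apply: measurable_dot.
by move=> /(_ measurableT [set 1] (measurable_set1 1)); rewrite setTI.
Qed.

(** The set consists of [xi] and [- xi]. *)
Lemma cone_measure_dot_sqr1 xi : cone [set eta | dot xi eta ^+ 2 = 1] = 0%E.
Proof.
have -> : [set eta | dot xi eta ^+ 2 = 1] = rotT (Psi (azi xi) (zen xi) 0) @^-1`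
    [set eta | dot (Phi 0 0) eta ^+ 2 = 1].
  by apply/funext => eta /=; rewrite -(rotT_north xi 0) dot_rotT.
rewrite cone_measure_rotT; last exact: measurable_dot_sqr1.
apply: (@subset_measure0 _ _ _ cone _ [set x : S2 R | val x 1 0 = 0]).
- exact: measurable_dot_sqr1.
- exact: measurable_meridian.
- move=> eta /=; rewrite north_dot => e2; have := S2E eta; rewrite e2 => h.
  apply/eqP; rewrite -sqrf_eq0 eq_le sqr_ge0 andbT.
  by have := sqr_ge0 (val eta 0 0); lra.
- exact: cone_measure_meridian.
Qed.

(** Otherwise a rectangle in the coordinate domain would be mapped into [N], and the
integral of the positive density [sin] over it would vanish. *)
Lemma uniform_S2_coordinates_dense (N : set (S2 R)) phi theta (e : R) :
  measurable N -> u N = 0%E -> 0 < phi < 2 * pi -> 0 < theta < pi -> 0 < e ->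
  exists s t, [/\ `|s - phi| <= e, `|t - theta| <= e & ~ N (Phi s t)].
Proof.
move=> mN uN0 /andP[phi0 phi2] /andP[theta0 thetapi] e0.
apply: contrapT => h.
have inN s t : `|s - phi| <= e -> `|t - theta| <= e -> N (Phi s t).
  by move=> hs ht; apply: contrapT => nN; apply: h; exists s, t.
pose lam := @lebesgue_measure R.
have pi0 := @pi_gt0 R.
pose d1 := Num.min e (Num.min (phi / 2) ((2 * pi - phi) / 2)).
pose d2 := Num.min e (Num.min (theta / 2) ((pi - theta) / 2)).
have d10 : 0 < d1 by rewrite !lt_min e0 /=; lra.
have d20 : 0 < d2 by rewrite !lt_min e0 /=; lra.
have [d1e d1a d1b] : [/\ d1 <= e, d1 <= phi / 2 & d1 <= (2 * pi - phi) / 2].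
  by rewrite /d1 !ge_min !lexx !orbT.
have [d2e d2a d2b] : [/\ d2 <= e, d2 <= theta / 2 & d2 <= (pi - theta) / 2].
  by rewrite /d2 !ge_min !lexx !orbT.
pose I : set R := `[phi - d1, phi + d1]%classic.
pose J : set R := `[theta - d2, theta + d2]%classic.
have mI : measurable I by exact: measurable_itv.
have mJ : measurable J by exact: measurable_itv.
have sub : I `*` J `<=` @spherical_domain R `&` (fun z => Phi z.1 z.2) @^-1` N.
  move=> [s t] [] /=; rewrite /I /J /= !in_itv/= => /andP[s1 s2] /andP[t1 t2].
  split; last by apply: inN; rewrite ler_norml; apply/andP; split; lra.
  by split; rewrite /= in_itv/=; apply/andP; split; lra.
have : (surface_measure N = 0)%E.
  move: uN0; rewrite /uniform_S2 /mscale/= => /eqP; rewrite mule_eq0 => /orP[|/eqP//].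
  by rewrite eqe invr_eq0 => /eqP h0; exfalso; lra.
rewrite /surface_measure; set D := _ `&` _ => int0.
have mD : measurable D.
  apply: measurableI; first exact: measurable_spherical_domain.
  by rewrite -[X in measurable X]setTI; exact: measurable_Phi.
have ms E : measurable_fun E (fun z : R * R => (sin z.2)%:E).
  apply: measurable_funTS; apply/measurable_EFinP.
  by apply: measurableT_comp => //; apply: continuous_measurable_fun;
    exact: continuous_sin.
have spos z : (I `*` J) z -> 0 < sin z.2.
  move=> [_]; rewrite /J /= in_itv/= => /andP[t1 t2].
  by apply: sin_gt0_pi; apply/andP; split; lra.
have abs0 : (\int[lam \x lam]_(z in D) `|(sin z.2)%:E| = 0)%E.
  rewrite -[RHS]int0; apply: eq_integral => -[s t].
  rewrite inE => -[[_ /=]]; rewrite in_itv/= => st _.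
  by rewrite ger0_norm// sin_ge0_pi.
have [/(_ abs0)[M [mM M0 sM]] _] := ae_eq_integral_abs (lam \x lam)%E mD (ms D).
have IJM : I `*` J `<=` M.
  move=> z zIJ; apply: sM => /= /(_ (sub _ zIJ)) []; apply/eqP.
  by rewrite gt_eqF// spos.
have IJ0 : (lam \x lam)%E (I `*` J) = 0%E.
  apply: (@subset_measure0 _ _ _ (lam \x lam)%E _ M) => //.
  exact: measurableX.
have : (lam I * lam J = 0)%E.
  by rewrite -IJ0; apply/esym; exact: product_measure1E.
rewrite /lam /I /J !lebesgue_measure_itv/= !lte_fin !ifT; [|lra|lra].
rewrite -!EFinB -EFinM => -[] /eqP; rewrite mulf_eq0 => /orP[] /eqP; lra.
Qed.

Variables p q : {finite_measure set (S2 R) -> \bar R}.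
Hypothesis pq : forall A : set (SO3 R), measurable A ->
  ((u \x p) (T_W @^-1` A) = (u \x q) (T_W @^-1` A))%E.

(** Equality of the images on sets, extended to functions and written as an iterated
integral. *)
Let integral_T_W (F : SO3 R -> R) : bounded_mfun F ->
  \int[u]_eta \int[p]_xi F (T_W (eta, xi)) =
  \int[u]_eta \int[q]_xi F (T_W (eta, xi)).
Proof.
move=> [mF [M FM]].
have bFT : bounded_mfun (fun z : S2 R * S2 R => F (T_W z)).
  split; last by exists M.
  by apply: measurableT_comp => //; exact: measurable_T_W.
apply: EFin_inj.
have pE (m : {finite_measure set (S2 R) -> \bar R}) :
    (\int[u]_eta \int[m]_xi F (T_W (eta, xi)))%:E =
    (\int[pushforward (u \x m)%E T_W]_A (F A)%:E)%E.
  rewrite (@Rintegral_product _ _ _ _ _ u m (fun z => F (T_W z)) bFT).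
  have mEF : measurable_fun setT (EFin \o F) by exact/measurable_EFinP.
  have iF := @integrable_pair _ _ _ _ _ u m (fun z => F (T_W z)) bFT.
  rewrite -(preimage_setT (@T_W R)) in iF *.
  exact/esym/(@integral_pushforward _ _ _ _ _ _ (@measurable_T_W R)
    (u \x m)%E setT (EFin \o F) mEF iF measurableT).
rewrite !pE; apply: eq_measure_integral; [exact: measurable_T_W..|].
by move=> ? ? A mA _; exact: pq.
Qed.

Let G n y eta xi := frame_kernel n y (T_W (eta, xi)).

Let bounded_G n y : bounded_mfun (fun z : S2 R * S2 R => G n y z.1 z.2).
Proof.
have [mF _] := bounded_mfun_frame_kernel n y; split.
  apply: (eq_measurable_fun (fun z : S2 R * S2 R => frame_kernel n y (T_W z))).
    by move=> [eta xi] _.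
  by apply: measurableT_comp => //; exact: measurable_T_W.
by exists (3 ^+ n) => z; exact: frame_kernel_bound.
Qed.

(** A factor depending on the pole of the frame localises the integral at [eta]. *)
Let ae_agree n y : exists N, [/\ measurable N, u N = 0%E &
  forall eta, ~ N eta -> \int[p]_xi G n y eta xi = \int[q]_xi G n y eta xi].
Proof.
have bG := bounded_G n y.
pose h (m : {finite_measure set (S2 R) -> \bar R}) eta := \int[m]_xi G n y eta xi.
have bh m : bounded_mfun (h m) := @bounded_mfun_Rintegral1 _ _ _ _ _ u m _ bG.
have inth m E : measurable E -> (\int[u]_(eta in E) (h m eta)%:E =
    (\int[u]_eta \int[m]_xi (\1_E (pole (T_W (eta, xi))) * G n y eta xi))%:E)%E.
  move=> mE.
  transitivity (\int[u]_eta (\1_E eta * h m eta))%:E.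
    rewrite EFin_Rintegral; last by apply: bounded_mfunM => //; exact: bounded_mfun_indic.
    rewrite integral_mkcond; apply: eq_integral => eta _.
    by rewrite patchE indicE; case: ifP; rewrite ?mul1r ?mul0r.
  congr (_%:E); apply: eq_Rintegral => eta _.
  under [RHS]eq_Rintegral do rewrite pole_T_W.
  rewrite RintegralZl//; apply: bounded_mfun_integrable.
  exact: (bounded_mfun_pair1 bG).
have : ae_eq u setT (EFin \o h p) (EFin \o h q).
  apply: integral_ae_eq => //.
  - exact: bounded_mfun_integrable.
  - by apply/measurable_EFinP; case: (bh q).
  move=> E _ mE; rewrite !inth//; congr (_%:E).
  apply: (integral_T_W (F := fun A => \1_E (pole A) * frame_kernel n y A)).
  apply: bounded_mfunM; last exact: bounded_mfun_frame_kernel.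
  have [mE1 [M EM]] := bounded_mfun_indic R mE; split; last by exists M.
  by apply: measurableT_comp => //; exact: measurable_pole.
move=> [N [mN N0 sN]]; exists N; split=> // eta nN.
apply: EFin_inj; apply: contrapT => ne; apply: nN; apply: sN => /= /(_ Logic.I).
exact: ne.
Qed.

(** [eta] is a limit of points at which the integrals of [G] agree, and along this
sequence [G] converges to [zkernel] for all [xi] other than [eta] and [- eta]. *)
Let agree_off_atoms n y eta : val eta 1 0 != 0 ->
  p [set xi | dot xi eta ^+ 2 = 1] = 0%E ->
  q [set xi | dot xi eta ^+ 2 = 1] = 0%E ->
  \int[p]_xi zkernel n y eta xi = \int[q]_xi zkernel n y eta xi.
Proof.
move=> eta1 p0 q0; have [phi0 theta0] := azi_zen_interior eta1.
have [N [mN N0 agN]] := ae_agree n y.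
have near_eta k : exists st : R * R, [/\ `|st.1 - azi eta| <= k.+1%:R^-1,
    `|st.2 - zen eta| <= k.+1%:R^-1 & ~ N (Phi st.1 st.2)].
  have k0 : 0 < k.+1%:R^-1 :> R by rewrite invr_gt0.
  have [s [t h]] := uniform_S2_coordinates_dense mN N0 phi0 theta0 k0.
  by exists (s, t).
have [st hst] := choice near_eta.
pose e_ k := Phi (st k).1 (st k).2.
have cvg_near (f : nat -> R) (l : R) : (forall k, `|f k - l| <= k.+1%:R^-1) -> f @ \oo --> l.
  move=> fl.
  apply: (@squeeze_cvgr _ _ _ _ (fun k => l - k.+1%:R^-1) (fun k => l + k.+1%:R^-1)).
  - by apply: nearW => k; rewrite -ler_distl.
  - by rewrite -[X in _ --> X]subr0; apply: cvgB; [exact: cvg_cst|exact: cvg_harmonic].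
  - by rewrite -[X in _ --> X]addr0; apply: cvgD; [exact: cvg_cst|exact: cvg_harmonic].
have cs : (fun k => (st k).1) @ \oo --> azi eta.
  by apply: cvg_near => k; have [] := hst k.
have ct : (fun k => (st k).2) @ \oo --> zen eta.
  by apply: cvg_near => k; have [] := hst k.
have ce x : dot x (e_ k) @[k --> \oo] --> dot x eta.
  exact: cvg_dot_Phi.
have lim_int (m : {finite_measure set (S2 R) -> \bar R}) :
    m [set xi | dot xi eta ^+ 2 = 1] = 0%E ->
    \int[m]_xi G n y (e_ k) xi @[k --> \oo] --> \int[m]_xi zkernel n y eta xi.
  move=> m0; apply: (@bounded_convergence _ _ _ m _ _ (3 ^+ n) _ _ m0).
  - by under eq_set do rewrite dotC; exact: measurable_dot_sqr1.
  - exact: (bounded_mfun_pair1 (bounded_mfun_zkernel n y)).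
  - by move=> k; have [] := bounded_mfun_pair1 (bounded_G n y) (e_ k).
  - by move=> k xi; exact: frame_kernel_bound.
  move=> xi /= /eqP d1.
  have cd : (1 - dot xi (e_ k) ^+ 2) @[k --> \oo] --> 1 - dot xi eta ^+ 2.
    apply: cvgB; first exact: cvg_cst.
    by rewrite expr2; under eq_fun do rewrite expr2; exact: cvgM.
  have d0 : 1 - dot xi eta ^+ 2 != 0 by rewrite subr_eq0 eq_sym.
  have := @cvg_zkernel n y _ _ _ ce d1; apply: cvg_trans; apply: near_eq_cvg.
  apply: (@filterS _ _ _ [set k | 1 - dot xi (e_ k) ^+ 2 != 0]); last first.
    exact: (cvgr_neq0 _ cd d0).
  move=> k /= dk; rewrite subr_eq0 eq_sym in dk.
  by rewrite /G frame_kernel_T_W.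
have h1 := lim_int p p0; have h2 := lim_int q q0.
have e : (fun k => \int[p]_xi G n y (e_ k) xi) = (fun k => \int[q]_xi G n y (e_ k) xi).
  by apply/funext => k; apply: agN; have [] := hst k.
by rewrite e in h1; rewrite -(cvg_lim _ h1)// -(cvg_lim _ h2).
Qed.

(** By Fubini, the integral over [eta] of the mass of the pair [eta], [- eta] is the
integral over [xi] of [cone [set xi; - xi]], which is zero. *)
Let cone_atoms (m : {finite_measure set (S2 R) -> \bar R}) :
  exists N, [/\ measurable N, cone N = 0%E &
    forall eta, ~ N eta -> m [set xi | dot xi eta ^+ 2 = 1] = 0%E].
Proof.
pose E : set (S2 R * S2 R) := [set z | dot z.2 z.1 ^+ 2 = 1].
have mE : measurable E.
  have : measurable_fun setT (fun z : S2 R * S2 R => dot z.2 z.1 ^+ 2).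
    by apply: measurable_funX; apply: measurable_dot.
  by move=> /(_ measurableT [set 1] (measurable_set1 1)); rewrite setTI.
have bE := bounded_mfun_indic R mE.
pose g eta := \int[m]_xi (\1_E (eta, xi) : R).
have bg : bounded_mfun g := @bounded_mfun_Rintegral1 _ _ _ _ _ cone m _ bE.
have g0 eta : 0 <= g eta by apply: Rintegral_ge0 => xi _; rewrite indicE.
have Ig : \int[cone]_eta g eta = 0.
  rewrite (@Rintegral_fubini _ _ _ _ _ cone m _ bE).
  rewrite -[RHS](mul0r (fine (m setT))) -Rintegral_cst//.
  apply: eq_Rintegral => xi _; apply: EFin_inj.
  have mEx : measurable [set eta | dot xi eta ^+ 2 = 1] := measurable_dot_sqr1 xi.
  rewrite -[RHS](cone_measure_dot_sqr1 xi) -(EFin_Rintegral_indic cone mEx).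
  by congr (_%:E).
have [N [mN N0 gN]] := Rintegral_eq0 bg g0 Ig.
exists N; split => // eta nN; have mEe := measurable_dot_sqr1 eta.
have -> : [set xi | dot xi eta ^+ 2 = 1] = [set xi | dot eta xi ^+ 2 = 1].
  by apply/funext => xi /=; rewrite dotC.
rewrite -(EFin_Rintegral_indic m mEe) -[RHS]/(0%:E) -(gN eta nN); congr (_%:E).
apply: eq_Rintegral => xi _; rewrite !indicE; congr (nat_of_bool _)%:R.
by apply/idP/idP; rewrite !inE /E/= dotC.
Qed.

Lemma nonnegative_injectivity B : measurable B -> p B = q B.
Proof.
apply: zonal_moments_determine => n y; rewrite /agree.
have c0 := @zonal_factor_gt0 R n.
suff : \int[p]_xi \int[cone]_eta zkernel n y eta xi =
       \int[q]_xi \int[cone]_eta zkernel n y eta xi.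
  under eq_Rintegral do rewrite Rintegral_zkernel.
  under [RHS]eq_Rintegral do rewrite Rintegral_zkernel.
  rewrite !RintegralZl//; try exact/bounded_mfun_integrable/bounded_mfun_poly_dot.
  by move/(mulfI (lt0r_neq0 c0)).
have bz := bounded_mfun_zkernel n y.
have fub (m : {finite_measure set (S2 R) -> \bar R}) :
    \int[m]_xi \int[cone]_eta zkernel n y eta xi =
    \int[cone]_eta \int[m]_xi zkernel n y eta xi.
  exact: (esym (@Rintegral_fubini _ _ _ _ _ cone m _ bz)).
rewrite !fub.
have [N1 [mN1 N10 h1]] := cone_atoms p; have [N2 [mN2 N20 h2]] := cone_atoms q.
pose M := [set x : S2 R | val x 1 0 = 0].
have mM : measurable M by exact: measurable_meridian.
apply: (@Rintegral_ae _ _ _ cone _ _ (N1 `|` N2 `|` M)).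
- by apply: measurableU => //; exact: measurableU.
- have mN12 : measurable (N1 `|` N2) by exact: measurableU.
  have N120 := @null_set_setU _ _ _ cone _ _ mN1 mN2 N10 N20.
  exact: (@null_set_setU _ _ _ cone _ _ mN12 mM N120 (@cone_measure_meridian R)).
- exact: (@bounded_mfun_Rintegral1 _ _ _ _ _ cone p _ bz).
- exact: (@bounded_mfun_Rintegral1 _ _ _ _ _ cone q _ bz).
move=> eta /not_orP[/not_orP[n1 n2] /eqP e1].
by apply: agree_off_atoms => //; [exact: h1|exact: h2].
Qed.

End nonnegative_injectivity.

(** * Injectivity on charges *)

Section jordan.
Context d (T : measurableType d) (R : realType).
Local Open Scope ereal_scope.

Lemma charge_difference (nu : {charge set T -> \bar R}) :
  exists a b : {finite_measure set T -> \bar R},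
    forall A, measurable A -> nu A = a A - b A.
Proof.
have [P [N nuPN]] := Hahn_decomposition nu.
exists (jordan_pos nuPN), (jordan_neg nuPN) => A mA.
rewrite (jordan_decomp nuPN)// /cadd /=; congr (_ + _).
exact: mulN1e.
Qed.

Variables a b : {finite_measure set T -> \bar R}.

Definition finite_measure_add : set T -> \bar R := measure_add a b.

HB.instance Definition _ := Measure.on finite_measure_add.

Let finite_measure_add_fin : fin_num_fun finite_measure_add.
Proof.
move=> A mA; rewrite /finite_measure_add measure_addE.
by rewrite fin_numD !fin_num_measure.
Qed.

HB.instance Definition _ := Measure_isFinite.Build _ _ _ finite_measure_add
  finite_measure_add_fin.

Lemma finite_measure_addE A : finite_measure_add A = a A + b A.
Proof. exact: measure_addE. Qed.

End jordan.

Section product_add.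
Context d1 d2 (T1 : measurableType d1) (T2 : measurableType d2) (R : realType).
Variables (m : {finite_measure set T1 -> \bar R})
  (a b : {finite_measure set T2 -> \bar R}).
Local Open Scope ereal_scope.

Lemma product_measure_add X : measurable X ->
  (m \x finite_measure_add a b) X = (m \x a) X + (m \x b) X.
Proof.
move=> mX; rewrite /product_measure1 -ge0_integralD//; last 2 first.
- exact: measurable_fun_xsection.
- exact: measurable_fun_xsection.
by apply: eq_integral => x _ /=; rewrite finite_measure_addE.
Qed.

Lemma product_measure_fin_num X : measurable X -> (m \x a) X \is a fin_num.
Proof.
move=> mX; rewrite ge0_fin_numE//; apply: (@le_lt_trans _ _ ((m \x a) setT)).
  by apply: le_measure => //; rewrite inE.
rewrite -setXTT product_measure1E//.
by rewrite lte_mul_pinfty// ?fin_num_measure// -ge0_fin_numE// fin_num_measure.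
Qed.

End product_add.

Theorem theorem4p10 (R : realType) (mu nu : {charge set (S2 R) -> \bar R}) :
  (forall A : set (SO3 R), measurable A ->
     semicircle_transform mu A = semicircle_transform nu A) ->
  forall B : set (S2 R), measurable B -> mu B = nu B.
Proof.
move=> WE B mB.
have [a [b muE]] := charge_difference mu; have [c [e nuE]] := charge_difference nu.
pose p := finite_measure_add a e; pose q := finite_measure_add c b.
have addE (w x y z : \bar R) : w \is a fin_num -> x \is a fin_num ->
    y \is a fin_num -> z \is a fin_num ->
    (w - x = y - z)%E <-> (w + z = y + x)%E.
  move=> /fineK <- /fineK <- /fineK <- /fineK <-.
  by rewrite -!EFinB -!EFinD; split => -[h]; congr (_%:E); lra.
have pq : p B = q B.
  apply: nonnegative_injectivity mB => A mA.
  have mTA : measurable (@T_W R @^-1` A).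
    by rewrite -[X in measurable X]setTI; exact: measurable_T_W.
  rewrite !product_measure_add//; apply/addE; rewrite ?product_measure_fin_num//.
  have := WE A mA; rewrite /semicircle_transform /= /semicircle_fun /pushforward.
  by rewrite (product_chargeE _ muE)// (product_chargeE _ nuE).
rewrite muE// nuE//; apply/addE; rewrite ?fin_num_measure//.
by move: pq; rewrite /p /q !finite_measure_addE.
Qed.
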